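(* Let $d\ge1$ and let $B=(B_x)_{x\in\mathbb R^d}$ be a centered, stationary, jointly measurable Gaussian field with continuous covariance function $C$, i.e. $\mathbb E[B_xB_y]=C(x-y)$, with $C(0)=1$. Suppose there exist constants $C_1,C_2,C_3,\alpha,\delta,\epsilon>0$ such that $$|C(x)|\le C_1\|x\|^{-\delta}\ \ \forall x\in\mathbb R^d,\qquad C_2\|x\|^\alpha\le 1-C(x)\le C_3\|x\|^\alpha\ \ \text{for }\|x\|\le\epsilon.$$ Let $E\subseteq\mathbb R^d$ be a compact set with positive Lebesgue measure, $\mu$ Lebesgue measure on $E$, and $V(u)=\int_E\mathbf 1_{\{B_x\ge u\}}\,dx$. Then for every $u\in\mathbb R$ and $p\in\mathbb N$: $V(u)\in\mathbb D^{p,2}$ if and only if $p<d/\alpha+\tfrac12$.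
   Context: Hermite polynomials: $H_0=1$, $H_1(x)=x$, $H_{q+1}(x)=xH_q(x)-qH_{q-1}(x)$; $\phi(x)=e^{-x^2/2}/\sqrt{2\pi}$. For $\varphi\in L^2(\mathbb R,\phi(x)dx)$, $a_q(\varphi)=\frac1{q!}\int_{\mathbb R}H_q\varphi\phi\,dx$, and for the functional $Y(\varphi)=\int_E\varphi(B_x)\mu(dx)$ one says $Y(\varphi)\in\mathbb D^{p,2}$ iff $\sum_{q\ge0}q^p\,q!\,a_q(\varphi)^2\int_{E^2}K(x,y)^q\,\mu(dx)\mu(dy)<\infty$, where $K(x,y)=\mathbb E[B_xB_y]$. Here $V(u)=Y(\mathbf 1_{[u,\infty)})$. *)

(* Defs.v *)
From HB Require Import structures.
From mathcomp Require Import all_boot all_order all_algebra.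
From mathcomp Require Import all_classical all_reals all_analysis.
Set Implicit Arguments. Unset Strict Implicit. Unset Printing Implicit Defensive.
Import Order.TTheory GRing.Theory Num.Theory.
Import numFieldNormedType.Exports.
Local Open Scope classical_set_scope.
Local Open Scope ring_scope.

Section Defs.
Variable R : realType.

(* Probabilists' Hermite polynomials: H_0 = 1, H_1 = x,
   H_{q+1} = x H_q - q H_{q-1}.  hermite_pair q x = (H_q x, H_{q+1} x). *)
Fixpoint hermite_pair (q : nat) (x : R) : R * R :=
  match q with
  | 0%N => (1, x)
  | q'.+1 => let: (a, b) := hermite_pair q' x in (b, x * b - q'.+1%:R * a)
  end.
Definition hermite (q : nat) (x : R) : R := (hermite_pair q x).1.

Definition gauss_density (x : R) : R :=
  expR (- (x ^+ 2) / 2) / Num.sqrt (2 * pi).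

Definition hermite_coef (phi : R -> R) (q : nat) : \bar R :=
  ((q`!%:R)^-1)%:E *
  (\int[@lebesgue_measure R]_x (hermite q x * phi x * gauss_density x)%:E)%E.

(* Y(phi) = \int_E phi(B_x) mu(dx) belongs to D^{p,2}  iff
   \sum_q q^p q! a_q(phi)^2 \int_{E^2} K(x,y)^q mu(dx) mu(dy) < oo *)
Definition in_Dp2 (dT : measure_display) (T : measurableType dT)
  (mu : {measure set T -> \bar R}) (E : set T) (K : T -> T -> R)
  (phi : R -> R) (p : nat) : Prop :=
  (\sum_(0 <= q <oo)
     (((q%:R : R) ^+ p * q`!%:R)%:E * (hermite_coef phi q ^+ 2) *
      \int[mu]_(x in E) \int[mu]_(y in E) ((K x y) ^+ q)%:E) < +oo)%E.

Definition tsub (d : nat) (x y : d.-tuple R) : d.-tuple R :=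
  [tuple tnth x i - tnth y i | i < d].
Definition tzero (d : nat) : d.-tuple R := [tuple (0 : R) | i < d].
Definition enorm (d : nat) (x : d.-tuple R) : R :=
  Num.sqrt (\sum_(i < d) tnth x i ^+ 2).
(* identification of row vectors (carrying the topology of R^d) with tuples *)
Definition rv2t (d : nat) (v : 'rV[R]_d) : d.-tuple R := [tuple v 0 i | i < d].
Definition t2rv (d : nat) (x : d.-tuple R) : 'rV[R]_d := \row_i tnth x i.

Definition is_lebesgue_Rd (d : nat)
  (mu : {measure set (d.-tuple R) -> \bar R}) : Prop :=
  forall a b : d.-tuple R, (forall i, tnth a i <= tnth b i) ->
    mu [set x | forall i, tnth a i <= tnth x i <= tnth b i] =
    (\prod_(i < d) (tnth b i - tnth a i))%:E.

(* C is the covariance function of a centered stationary Gaussian field: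
   even and positive semidefinite *)
Definition pos_def_fun (d : nat) (C : d.-tuple R -> R) : Prop :=
  (forall x, C (tsub (tzero d) x) = C x) /\
  forall (n : nat) (x : 'I_n -> d.-tuple R) (c : 'I_n -> R),
    0 <= \sum_(i < n) \sum_(j < n) c i * c j * C (tsub (x i) (x j)).

End Defs.

(* Main.v *)
Require Import Defs.
From HB Require Import structures.
From mathcomp Require Import all_boot all_order all_algebra.
From mathcomp Require Import all_classical all_reals all_analysis.
From mathcomp Require Import measurable_realfun ring lra.
Set Implicit Arguments.
Unset Strict Implicit.
Import Order.TTheory GRing.Theory Num.Theory.
Import numFieldNormedType.Exports.
Local Open Scope classical_set_scope.
Local Open Scope ring_scope.

(** For q >= 1 the Hermite coefficient of the indicator of [u, oo) is
    H_{q-1}(u) phi(u) / q!, so the series has general term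
      q^(p-1) phi(u)^2 (H_{q-1}(u)^2 / (q-1)!) I_q,
      I_q = int_E int_E C(x - y)^q dx dy.
    A discrete energy of the three-term recurrence shows that H_q(u)^2 / q! is
    O(q^(-1/2)) and that the sum of two consecutive such quantities is at least
    c q^(-1/2).  Positive definiteness and decay at infinity keep |C| away from
    1 off the origin, so that only the region |x - y| <~ q^(-1/alpha) matters
    and I_q is of exact order q^(-d/alpha).  The series thus behaves like
    sum q^(p - 3/2 - d/alpha), which converges iff p < d/alpha + 1/2. *)

(** * Hermite polynomials *)

(** Single values [H_q(u)] may vanish (every odd one does at [u = 0]), so no termwise lower bound
    exists and consecutive terms must be taken together. The energy is the invariant of a frozen
    recurrence: put [g_q = H_q(x) / sqrt(q!)] and replace all square roots in its recurrence by one
    constant [s]. Then [s (g'' + g) = x g'], and [s g^2 + s g'^2 - x g g'] is conserved, because its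
    increment factors as [(g'' - g) (s (g'' + g) - x g')]. The true coefficients vary slowly, so the
    form is almost conserved. For large [q] it is comparable to [sqrt q (g^2 + g'^2)], which
    explains the order [q^(-1/2)]. For odd [q] the power [C^q] can be negative, so even the sign of
    [I_q] is not free. The bound must therefore concern [|C|]: a value of [C] near -1 away from the
    origin would be as harmful as one near 1. Both are excluded by the inequality
    [C(2x) >= 2 C(x)^2 - 1], the positive definite counterpart of the duplication formula of the
    cosine. At the critical [p = d/alpha + 1/2] the comparison series is harmonic, hence the strict
    inequality. *)

Lemma hermiteSS (R : realType) (q : nat) (x : R) :
  hermite q.+2 x = x * hermite q.+1 x - q.+1%:R * hermite q x.
Proof.
by rewrite /hermite /=; case: (hermite_pair q x) => a b.
Qed.

(** With [s], [t], [w] the square roots of [q+1], [q+2], [q+3], the left side is the increment of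
    the energy. Bounded separately, its two terms are of order [1/s], that is [1/q] relative to an
    energy of order [s], which is not summable. Eliminating [g3] by the recurrence leaves [x g1 g2]
    with a coefficient of order [s^(-2)], and makes the coefficient of [g1^2] the second-order
    quantity [D1 - D2 t / w]. *)
Lemma energy_increment_bound (R : realType) (x s t w g1 g2 g3 : R) :
  1 <= s -> 0 < t -> 0 < w -> t ^+ 2 = s ^+ 2 + 1 -> w ^+ 2 = s ^+ 2 + 2 ->
  w * g3 = x * g2 - t * g1 ->
  `|(w - t) * g1 * g3 + (t - s) * g1 ^+ 2| <=
    (`|x| + 1) / s ^+ 2 * (g1 ^+ 2 + g2 ^+ 2).
Proof.
move=> s1 t0 w0 t2 w2 rec.
have s0 : 0 < s by lra.
have st : s <= t by nra.
have tw : t <= w by nra.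
have -> : (w - t) * g1 * g3 + (t - s) * g1 ^+ 2 =
   (w - t) / w * x * (g1 * g2) + ((t - s) - (w - t) * t / w) * g1 ^+ 2.
  have -> : g3 = (x * g2 - t * g1) / w by rewrite -rec mulrC mulKf ?gt_eqF.
  by field; rewrite gt_eqF.
have wt : w - t = (w + t)^-1.
  apply: (mulIf (x := w + t)); first by rewrite gt_eqF ?addr_gt0.
  rewrite mulVf ?gt_eqF ?addr_gt0 //; nra.
have ts : t - s = (t + s)^-1.
  apply: (mulIf (x := t + s)); first by rewrite gt_eqF ?addr_gt0.
  rewrite mulVf ?gt_eqF ?addr_gt0 //; nra.
have a0 : 0 <= (w - t) / w by rewrite divr_ge0 ?subr_ge0 // ltW.
have a1 : (w - t) / w <= (s ^+ 2)^-1.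
  rewrite wt -invfM lef_pV2 ?posrE ?exprn_gt0 ?mulr_gt0 ?addr_gt0 //; nra.
set D1 := t - s; set D2 := w - t.
have D10 : 0 <= D1 by rewrite /D1; lra.
have D20 : 0 <= D2 by rewrite /D2; lra.
have e1 : D1 * (t + s) = 1 by rewrite /D1; nra.
have e2 : D2 * (w + t) = 1 by rewrite /D2; nra.
have D12 : D2 <= D1.
  have : D1 * (w + t) >= 1 by rewrite -e1 ler_wpM2l //; lra.
  rewrite -e2 ler_pM2r //; lra.
have f1 : s * D1 <= 2^-1 by nra.
have f2 : s * D2 <= 2^-1 by nra.
have f3 : (s ^+ 2 * (D1 - D2)) * (w + t) = (s * D1) * (s * D1 + s * D2).
  have -> : s ^+ 2 * (D1 - D2) * (w + t) =
    s ^+ 2 * (D1 * (w + t) - D2 * (w + t)) by ring.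
  rewrite e2 -e1 /D1 /D2; ring.
have f4 : s ^+ 2 * (D1 - D2) <= 2^-1.
  have : (s ^+ 2 * (D1 - D2)) * (w + t) <= 2^-1 * (w + t).
    rewrite f3.
    have : (s * D1) * (s * D1 + s * D2) <= 2^-1 * 1.
      by apply: ler_pM; rewrite ?addr_ge0 ?mulr_ge0 ?(ltW s0) //; lra.
    by lra.
  rewrite ler_pM2r //; lra.
have b0 : 0 <= D1 - D2 * t / w.
  rewrite subr_ge0 ler_pdivrMr //; apply: ler_pM => //; exact: ltW.
have b1 : D1 - D2 * t / w <= (s ^+ 2)^-1.
  have -> : D1 - D2 * t / w = (D1 - D2) + D2 ^+ 2 / w.
    by rewrite /D2; field; rewrite gt_eqF.
  rewrite -[leRHS]mul1r ler_pdivlMr ?exprn_gt0 //.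
  rewrite mulrDl [_ * s ^+ 2]mulrC.
  have h : D2 ^+ 2 / w * s ^+ 2 <= 2^-1.
    have -> : D2 ^+ 2 / w * s ^+ 2 = (s * D2) ^+ 2 / w by ring.
    rewrite ler_pdivrMr //.
    have : (s * D2) ^+ 2 <= 2^-1 * 2^-1.
      by rewrite expr2; apply: ler_pM; rewrite ?mulr_ge0 ?(ltW s0).
    have : 1 <= w by lra.
    lra.
  by rewrite -[leRHS](_ : 2^-1 + 2^-1 = 1) ?lerD //; lra.
have s20 : 0 <= (s ^+ 2)^-1 by rewrite invr_ge0 sqr_ge0.
apply: (le_trans (ler_normD _ _)).
rewrite [X in _ + X]ger0_norm; last exact: mulr_ge0 b0 (sqr_ge0 _).
rewrite !normrM (ger0_norm D20) [`|w^-1|]ger0_norm ?invr_ge0 ?(ltW w0) //.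
have g12 : `|g1| * `|g2| <= g1 ^+ 2 + g2 ^+ 2.
  rewrite -(real_normK (num_real g1)) -(real_normK (num_real g2)).
  have := sqr_ge0 (`|g1| - `|g2|); nra.
have -> : (`|x| + 1) / s ^+ 2 * (g1 ^+ 2 + g2 ^+ 2) =
  (s ^+ 2)^-1 * `|x| * (g1 ^+ 2 + g2 ^+ 2) + (s ^+ 2)^-1 * (g1 ^+ 2 + g2 ^+ 2).
  by ring.
apply: lerD.
  apply: ler_pM => //; rewrite ?mulr_ge0 ?invr_ge0 ?(ltW w0) //.
  by rewrite ler_wpM2r.
apply: ler_pM => //; rewrite ?sqr_ge0 //.
by rewrite lerDl sqr_ge0.
Qed.

(** A bootstrap: while [F n <= 2 F 0], the increments telescope to at most [2 F 0 * b 0 <= F 0 / 2],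
    which keeps [F] within the assumed range. *)
Lemma slowly_varying_bounded (R : realType) (F b : nat -> R) :
  0 < F 0%N -> (forall n, 0 <= b n) -> (forall n, b n.+1 <= b n) -> b 0%N <= 4^-1 ->
  (forall n, `|F n.+1 - F n| <= (b n - b n.+1) * F n) ->
  forall n, F 0%N / 2 <= F n <= F 0%N * 2.
Proof.
move=> F0 b0 bd b04 dF.
have H n : `|F n - F 0%N| <= 2 * F 0%N * (b 0%N - b n).
  elim: n => [|n IH]; first by rewrite !subrr normr0 mulr0.
  have bn0 : b n <= b 0%N.
    by elim: (n) => // m; apply: le_trans; exact: bd.
  have Fn : F n <= 2 * F 0%N.
    move: IH; rewrite ler_norml => /andP[_ IH].
    have := b0 n; nra.
  have := dF n; have := bd n => bdn; move: IH; rewrite !ler_norml => /andP[p1 p2] /andP[q1 q2].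
  by apply/andP; split; nra.
move=> n; have := H n; have := b0 n; rewrite ler_norml => bn /andP[h1 h2].
by apply/andP; split; nra.
Qed.

(** * Energy estimates for the normalized three-term recurrence *)

Section recurrence.
Variables (R : realType) (x : R) (g : nat -> R).
Hypothesis g_rec : forall q,
  Num.sqrt q.+2%:R * g q.+2 = x * g q.+1 - Num.sqrt q.+1%:R * g q.
Hypothesis g0 : g 0%N != 0.

Let r (q : nat) : R := Num.sqrt q%:R.
(* Discrete energy of the recurrence: its relative variation is O(q^(-3/2)),
   hence summable. *)
Let F (q : nat) : R :=
  r q.+1 * g q.+1 ^+ 2 + r q.+2 * g q.+2 ^+ 2 - x * g q.+1 * g q.+2.

Local Lemma r_gt0 q : 0 < r q.+1.
Proof. by rewrite sqrtr_gt0 ltr0n. Qed.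

Local Lemma r_sqr q : r q ^+ 2 = q%:R.
Proof. by rewrite sqr_sqrtr. Qed.

Local Lemma r_ge (a : R) : exists N : nat, forall q, (N <= q)%N -> a <= r q.
Proof.
exists (Num.trunc (a ^+ 2)).+1 => q Nq.
apply: (le_trans (ler_norm _)); rewrite -sqrtr_sqr ler_sqrt //.
apply/ltW/(lt_le_trans (truncnS_gt _)); first by rewrite ler_nat.
Qed.

(** Two consecutive zeros would propagate down to [g 0]. This makes the energy at the starting index
    strictly positive. *)
Local Lemma rec_neq0 q : (g q != 0) || (g q.+1 != 0).
Proof.
elim: q => [|q IH]; first by rewrite g0.
apply: contraT; rewrite negb_or !negbK => /andP[/eqP a /eqP b].
move: IH; rewrite a eqxx orbF.
have := g_rec q; rewrite a b !mulr0 sub0r => /esym/eqP.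
by rewrite oppr_eq0 mulf_eq0 sqrtr_eq0 lern0 /= => ->.
Qed.

(** The threshold bounds the cross term by a quarter of [r q.+1 * (g q.+1 ^+ 2 + g q.+2 ^+ 2)]; its
    [+ 1] gives [r q.+1 >= 1], hence [r q.+2 <= 2 * r q.+1]. *)
Local Lemma energy_equiv q : 2 * `|x| + 1 <= r q.+1 ->
  r q.+1 / 2 * (g q.+1 ^+ 2 + g q.+2 ^+ 2) <= F q <=
  3 * r q.+1 * (g q.+1 ^+ 2 + g q.+2 ^+ 2).
Proof.
move=> xr; rewrite /F.
have := r_sqr q.+1; have := r_sqr q.+2; have := r_gt0 q; have := r_gt0 q.+1.
set s := r q.+1; set t := r q.+2; set a := g q.+1; set b := g q.+2.
rewrite -[q.+2%:R]natr1 => t0 s0 t2 s2.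
have x0 := normr_ge0 x.
have st : s <= t by nra.
have ts : t <= 2 * s by rewrite -/s in xr; nra.
have g12 : `|x * a * b| <= `|x| * ((a ^+ 2 + b ^+ 2) / 2).
  rewrite -mulrA normrM ler_wpM2l // normrM.
  rewrite -(real_normK (num_real a)) -(real_normK (num_real b)).
  have := sqr_ge0 (`|a| - `|b|); nra.
have h : `|x * a * b| <= s / 4 * (a ^+ 2 + b ^+ 2).
  apply: (le_trans g12); rewrite [leLHS]mulrA mulrAC ler_wpM2r ?addr_ge0 ?sqr_ge0 //.
  by rewrite -/s in xr; lra.
move: h; rewrite ler_norml => /andP[h1 h2].
have a2 := sqr_ge0 a; have b2 := sqr_ge0 b.
have tb : s * b ^+ 2 <= t * b ^+ 2 by rewrite ler_wpM2r.
have tb' : t * b ^+ 2 <= 2 * s * b ^+ 2 by rewrite ler_wpM2r.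
have sa : 0 <= s * a ^+ 2 by rewrite mulr_ge0 // ltW.
have sb : 0 <= s * b ^+ 2 by rewrite mulr_ge0 // ltW.
by apply/andP; split; nra.
Qed.

(** The factor is a difference of consecutive values of [1 / r] so that it telescopes. In the 12, a
    2 comes from the lower half of [energy_equiv] and a 6 from [1/s - 1/t = 1 / (s t (t + s)) >= 1 /
    (6 s^3)], valid as [t <= 2 s]. *)
Local Lemma energy_increment q : 2 * `|x| + 1 <= r q.+1 ->
  `|F q.+1 - F q| <= 12 * (`|x| + 1) * ((r q.+1)^-1 - (r q.+2)^-1) * F q.
Proof.
move=> xr; have /andP[Fl _] := energy_equiv xr.
have := r_sqr q.+1; have := r_sqr q.+2; have := r_sqr q.+3.
have := r_gt0 q; have := r_gt0 q.+1; have := r_gt0 q.+2.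
have rec := g_rec q.+1.
move: Fl; rewrite {2 3}/F -!/(r _).
have -> : r q.+2 * g q.+2 ^+ 2 + r q.+3 * g q.+3 ^+ 2 - x * g q.+2 * g q.+3 -
   (r q.+1 * g q.+1 ^+ 2 + r q.+2 * g q.+2 ^+ 2 - x * g q.+1 * g q.+2) =
   (r q.+3 - r q.+2) * g q.+1 * g q.+3 + (r q.+2 - r q.+1) * g q.+1 ^+ 2.
  rewrite -/(r q.+3) -/(r q.+2) in rec.
  transitivity (g q.+3 * (r q.+3 * g q.+3) - x * g q.+2 * g q.+3 -
    (r q.+1 * g q.+1 ^+ 2  - x * g q.+1 * g q.+2)); first by ring.
  transitivity ((r q.+3 * g q.+3) * g q.+1
    - r q.+2 * g q.+1 * g q.+3 + (r q.+2 - r q.+1) * g q.+1 ^+ 2); last by ring.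
  by rewrite rec; ring.
rewrite -/(r q.+3) -/(r q.+2) in rec.
move=> Fl w0 t0 s0; rewrite -[q.+3%:R]natr1 -[q.+2%:R]natr1 => w2 t2 s2.
have x0 := normr_ge0 x.
have s1 : 1 <= r q.+1 by lra.
have {}t2 : r q.+2 ^+ 2 = r q.+1 ^+ 2 + 1 by rewrite t2 s2.
have {}w2 : r q.+3 ^+ 2 = r q.+1 ^+ 2 + 2 by rewrite w2 s2; ring.
apply: (le_trans (energy_increment_bound s1 t0 w0 t2 w2 rec)).
move: Fl t0 s0 t2 w2 s1 x0; clear.
set s := r q.+1; set t := r q.+2; set G := g q.+1 ^+ 2 + _ => Fl t0 s0 t2 w2 s1 x0.
have st : t <= 2 * s by nra.
have e : s^-1 - t^-1 = (s * t * (t + s))^-1.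
  have : (t - s) * (t + s) = 1 by nra.
  move=> h; have -> : s^-1 - t^-1 = (t - s) / (s * t).
    by field; rewrite ?gt_eqF.
  apply: (mulIf (x := s * t * (t + s))); first by rewrite gt_eqF // !mulr_gt0 // addr_gt0.
  rewrite mulVf; last by rewrite gt_eqF // !mulr_gt0 // addr_gt0.
  rewrite -h; field; rewrite !gt_eqF //.
have k : (6 * s ^+ 3)^-1 <= s^-1 - t^-1.
  rewrite e lef_pV2 ?posrE ?mulr_gt0 ?exprn_gt0 ?addr_gt0 //.
  have : s * t * (t + s) <= s * (2 * s) * (2 * s + s).
    apply: ler_pM; rewrite ?mulr_ge0 ?addr_ge0 ?(ltW s0) ?(ltW t0) ?lerD //.
    by rewrite ler_wpM2l // ltW.
  by move/le_trans; apply; rewrite le_eqVlt; apply/orP; left; apply/eqP; ring.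
have G0 : 0 <= G by rewrite addr_ge0 // sqr_ge0.
have -> : (`|x| + 1) / s ^+ 2 * G =
   12 * (`|x| + 1) * (6 * s ^+ 3)^-1 * (s / 2 * G).
  by field; rewrite gt_eqF.
apply: ler_pM => //.
- by rewrite !mulr_ge0 ?addr_ge0 ?invr_ge0 ?mulr_ge0 ?exprn_ge0 ?(ltW s0).
- by rewrite mulr_ge0 // divr_ge0 // ltW.
- by rewrite ler_wpM2l // mulr_ge0 // addr_ge0.
Qed.

Lemma hermite_recurrence_bounds : exists (c K : R) (N : nat), 0 < c /\ 0 < K /\
  forall q, (N <= q)%N -> g q ^+ 2 <= K / Num.sqrt q%:R /\
     c / Num.sqrt q%:R <= g q ^+ 2 + g q.+1 ^+ 2.
Proof.
have [N0 HN0] := r_ge (2 * `|x| + 1).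
(* 48 is four times the 12 of [energy_increment]: it brings the first [L / r] below 1/4, as
   [slowly_varying_bounded] requires. *)
have [N1 HN1] := r_ge (48 * (`|x| + 1)).
pose N := maxn N0 N1.
have big q : 2 * `|x| + 1 <= r (N + q).+1.
  by apply: HN0; rewrite leqW // (leq_trans (leq_maxl _ N1)) // leq_addr.
pose L : R := 12 * (`|x| + 1).
have L0 : 0 < L by rewrite mulr_gt0 // ltr_wpDl.
have F0 : 0 < F N.
  have bigN := big 0%N; rewrite addn0 in bigN.
  have /andP[h _] := energy_equiv bigN.
  apply: lt_le_trans h; rewrite mulr_gt0 ?divr_gt0 ?r_gt0 //.
  rewrite lt0r addr_ge0 ?sqr_ge0 // andbT paddr_eq0 ?sqr_ge0 //.
  by rewrite !sqrf_eq0 negb_and rec_neq0.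
have H : forall n, F N / 2 <= F (N + n) <= F N * 2.
  have := @slowly_varying_bounded R (fun n => F (N + n)%N) (fun n => L / r (N + n).+1).
  rewrite addn0; apply => //.
  - by move=> n; rewrite divr_ge0 ?sqrtr_ge0 // ltW.
  - move=> n; rewrite ler_pM2l // lef_pV2 ?posrE ?r_gt0 //.
    by rewrite ler_sqrt // ler_nat addnS.
  - rewrite ler_pdivrMr ?r_gt0 //.
    have : 48 * (`|x| + 1) <= r N.+1 by apply: HN1; rewrite leqW // leq_maxr.
    rewrite /L; lra.
  - move=> n; rewrite addnS -mulrBr; exact: energy_increment.
(* [F N / 2 <= F <= 2 * F N] is combined with the factors 3 and 1/2 of [energy_equiv]. The start is
   [N.+1] because [F q] involves [g] at [q.+1] and [q.+2]. *)
exists (F N / 6), (4 * F N), N.+1; split; first by rewrite divr_gt0.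
split; first by rewrite mulr_gt0.
move=> [//|q]; rewrite ltnS => Nq; have /andP[h1 h2] := H (q - N)%N.
have := big (q - N)%N; rewrite subnKC // => bq; rewrite !subnKC // in h1 h2.
have /andP[k1 k2] := energy_equiv bq.
rewrite -/(r q.+1); split.
  rewrite ler_pdivlMr ?r_gt0 //.
  have : r q.+1 / 2 * g q.+1 ^+ 2 <= r q.+1 / 2 * (g q.+1 ^+ 2 + g q.+2 ^+ 2).
    by rewrite ler_wpM2l ?divr_ge0 ?sqrtr_ge0 // lerDl sqr_ge0.
  lra.
rewrite ler_pdivrMr ?r_gt0 //; lra.
Qed.

End recurrence.

Lemma hermite_asymp (R : realType) (x : R) : exists (c K : R) (N : nat),
  0 < c /\ 0 < K /\ forall q, (N <= q)%N ->
  hermite q x ^+ 2 / q`!%:R <= K / Num.sqrt q%:R /\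
  c / Num.sqrt q%:R <=
    hermite q x ^+ 2 / q`!%:R + hermite q.+1 x ^+ 2 / q.+1`!%:R.
Proof.
pose g q : R := hermite q x / Num.sqrt q`!%:R.
have f0 q : 0 < Num.sqrt (q`!%:R : R) by rewrite sqrtr_gt0 ltr0n fact_gt0.
have s0 q : 0 < Num.sqrt (q.+1%:R : R) by rewrite sqrtr_gt0 ltr0n.
have fS q : Num.sqrt (q.+1`!%:R : R) = Num.sqrt q.+1%:R * Num.sqrt q`!%:R.
  by rewrite factS natrM sqrtrM.
have [||c [K [N [c0 [K0 H]]]]] := @hermite_recurrence_bounds R x g.
- move=> q; rewrite /g hermiteSS !fS.
  have h : q.+1%:R = Num.sqrt q.+1%:R ^+ 2 :> R by rewrite sqr_sqrtr.
  rewrite {1}h; field; by rewrite !gt_eqF.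
- by rewrite /g mulf_neq0 ?invr_eq0 ?gt_eqF // /hermite /= oner_eq0.
exists c, K, N; split => //; split => // q /H.
by rewrite /g !expr_div_n !sqr_sqrtr.
Qed.

(** * Hermite coefficients of the indicator of a half-line *)

Section hermite_integral.
Variable R : realType.
Implicit Types (q : nat) (x u : R).

(** At [q = 0] the zero factor cancels the conventional value [hermite 0.-1]. *)
Lemma is_derive_hermite q x :
  is_derive x 1 (hermite q) (q%:R * hermite q.-1 x).
Proof.
suff [] : is_derive x 1 (@hermite R q) (q%:R * hermite q.-1 x) /\
  is_derive x 1 (@hermite R q.+1) (q.+1%:R * hermite q x) by [].
elim: q => [|q [IH1 IH2]]; split => //.
- by rewrite mul0r; exact: is_derive_cst.
- by rewrite mulr1; exact: is_derive_id.
- rewrite (_ : hermite q.+2 = (fun x => x * hermite q.+1 x - q.+1%:R * hermite q x)); last first.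
    by apply/funext => y; rewrite hermiteSS.
  rewrite [X in is_derive _ _ X _](_ : _ = id * @hermite R q.+1 - q.+1%:R *: @hermite R q).
    apply: is_derive_eq; rewrite /GRing.scale /=.
    have -> : hermite q.+1 x = x * hermite q x - q%:R * hermite q.-1 x.
      by case: (q) => [|m]; rewrite ?hermiteSS //= mul0r subr0 /hermite /= mulr1.
    by rewrite -!natr1; ring.
  by apply/funext => y.
Qed.

Lemma is_derive_gauss_density x :
  is_derive x 1 (@gauss_density R) (- x * gauss_density x).
Proof.
rewrite (_ : @gauss_density R = (Num.sqrt (2 * pi))^-1 *: (expR \o (fun x => - 2^-1 * x ^+ 2))).
  apply: is_derive_eq; rewrite /GRing.scale /= /GRing.scale /=.
  by field; rewrite sqrtr_eq0 -ltNge mulr_gt0 // pi_gt0.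
apply/funext => y; rewrite /gauss_density /GRing.scale /= mulrC.
by congr (_ * expR _); lra.
Qed.

(** An exponential bound is stable under the recurrence, since [|x| <= exp |x|], and the Gaussian
    factor still absorbs it. *)
Lemma hermite_bound q : exists2 A, 0 <= A & forall x, `|hermite q x| <= A * expR (q%:R * `|x|).
Proof.
suff [] : (exists2 A, 0 <= A & forall x : R, `|hermite q x| <= A * expR (q%:R * `|x|)) /\
  (exists2 A, 0 <= A & forall x : R, `|hermite q.+1 x| <= A * expR (q.+1%:R * `|x|)) by [].
have xe x : `|x| <= expR `|x|.
  by apply: le_trans (expR_ge1Dx _); rewrite lerDr.
elim: q => [|q [[A A0 IH1] [B B0 IH2]]]; split => //.
- by exists 1 => // x; rewrite mul0r expR0 mulr1 /hermite normr1.
- by exists 1 => // x; rewrite !mul1r.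
- by exists B.
exists (B + q.+1%:R * A); first by rewrite addr_ge0 ?mulr_ge0.
move=> x; rewrite hermiteSS; apply: (le_trans (ler_normB _ _)).
rewrite mulrDl; apply: lerD; rewrite normrM.
  rewrite -[q.+2%:R]natr1 mulrDl mul1r expRD mulrA mulrC.
  exact: ler_pM.
rewrite ger0_norm // -mulrA ler_wpM2l //; apply: (le_trans (IH1 _)).
by rewrite ler_wpM2l // ler_expR ler_wpM2r // ler_nat leqW.
Qed.

Lemma hermite_gauss_bound q : exists2 K, 0 <= K &
  forall x, `|hermite q x * gauss_density x| <= K * expR (- `|x|).
Proof.
have [A A0 HA] := hermite_bound q.
(* Completing the square: [q |x| - x^2/2 <= (q+1)^2/2 - |x|]. The shift from [q] to [q+1] is what
   leaves the factor [exp(- |x|)]. *)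
exists (A * (expR (q.+1%:R ^+ 2 / 2) / Num.sqrt (2 * pi))).
  by rewrite mulr_ge0 // divr_ge0 ?sqrtr_ge0 // expR_ge0.
move=> x; rewrite normrM [`|gauss_density x|]ger0_norm; last first.
  by rewrite divr_ge0 ?sqrtr_ge0 // expR_ge0.
apply: (@le_trans _ _ (A * expR (q%:R * `|x|) * gauss_density x)).
  by rewrite ler_wpM2r // divr_ge0 ?sqrtr_ge0 // expR_ge0.
rewrite /gauss_density -!mulrA ler_wpM2l // [leRHS]mulrCA [leRHS]mulrC !mulrA.
rewrite ler_wpM2r ?invr_ge0 ?sqrtr_ge0 // -!expRD ler_expR.
rewrite -[q.+1%:R]natr1 -(real_normK (num_real x)).
have := sqr_ge0 (`|x| - (q%:R + 1)); nra.
Qed.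

Lemma continuous_hermite_gauss q : continuous (fun x => hermite q x * gauss_density x).
Proof.
move=> x; apply: cvgM; apply: differentiable_continuous; apply/derivable1_diffP.
  by have [] := is_derive_hermite q x.
by have [] := is_derive_gauss_density x.
Qed.

Lemma is_derive_hermite_gauss q x :
  is_derive x 1 (fun x => hermite q x * gauss_density x)
    (- (hermite q.+1 x * gauss_density x)).
Proof.
have ? := is_derive_hermite q x; have ? := is_derive_gauss_density x.
rewrite (_ : (fun x => _) = hermite q * @gauss_density R) //.
apply: is_derive_eq; rewrite /GRing.scale /=.
have -> : hermite q.+1 x = x * hermite q x - q%:R * hermite q.-1 x.
  by case: (q) => [|m]; rewrite ?hermiteSS //= mul0r subr0 /hermite /= mulr1.
ring.
Qed.

Local Notation mu := (@lebesgue_measure R).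

Lemma continuous_mul_expRN (K : R) : continuous (fun x => K * expR (- x)).
Proof.
move=> x; apply: cvgMl_tmp; apply: continuous_comp; first exact: continuousN.
exact: continuous_expR.
Qed.

Lemma integral_expRN u (K : R) : 0 <= K ->
  (\int[mu]_(x in `[u, +oo[) (K * expR (- x))%:E = (K * expR (- u))%:E)%E.
Proof.
move=> K0.
have dF x : is_derive x 1 (fun x => - (K * expR (- x))) (K * expR (- x)).
  rewrite (_ : (fun x => _) = - (K *: (expR \o -%R))) //.
  by apply: is_derive_eq; rewrite /GRing.scale /=; ring.
have cF x : {for x, continuous (fun x => - (K * expR (- x)))}.
  by apply: differentiable_continuous; apply/derivable1_diffP; have [] := dF x.
rewrite (@ge0_continuous_FTC2y R _ (fun x => - (K * expR (- x))) u 0).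
- by rewrite -EFinB sub0r opprK.
- by move=> x _; rewrite mulr_ge0 // expR_ge0.
- by apply: continuous_subspaceT => x; exact: continuous_mul_expRN.
- have -> : 0 = - (K * 0) :> R by rewrite mulr0 oppr0.
  by apply: cvgN; apply: cvgMl_tmp; exact: cvgr_expR.
- by move=> x _; have [] := dF x.
- exact/cvg_at_right_filter/cF.
- by move=> x _; rewrite derive1E; have [_ ->] := dF x.
Unshelve. all: by end_near. Qed.


Lemma integrable_expRN u (K : R) : 0 <= K ->
  mu.-integrable `[u, +oo[ (fun x => (K * expR (- x))%:E).
Proof.
move=> K0; apply/integrableP; split.
  apply/measurable_EFinP; apply: measurable_funTS.
  apply: measurable_funM => //; apply: measurableT_comp => //.
under eq_integral do rewrite gee0_abs ?lee_fin ?mulr_ge0 ?expR_ge0 //.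
by rewrite integral_expRN // ltry.
Qed.

Lemma integrable_hermite_gauss u q :
  mu.-integrable `[u, +oo[ (fun x => (hermite q x * gauss_density x)%:E).
Proof.
have [K K0 HK] := hermite_gauss_bound q.
apply: (@le_integrable _ _ _ _ _ _ _ _ _ _ (integrable_expRN u K0)) => //.
  apply/measurable_EFinP; apply: measurable_funTS.
  apply: continuous_measurable_fun; exact: continuous_hermite_gauss.
move=> x _; rewrite lee_fin [leRHS]ger0_norm ?mulr_ge0 ?expR_ge0 //.
apply: (le_trans (HK x)); rewrite ler_wpM2l // ler_expR lerN2; exact: ler_norm.
Qed.

Lemma integral_hermite_gauss u q :
  (\int[mu]_(x in `[u, +oo[) (hermite q.+1 x * gauss_density x)%:E =
   (hermite q u * gauss_density u)%:E)%E.
Proof.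
have [K K0 HK] := hermite_gauss_bound q.+1.
have [K' K'0 HK'] := hermite_gauss_bound q.
(* The fundamental theorem on a half-line is available for nonnegative
   functions, whence the correction K e^(-x). *)
pose f x := hermite q.+1 x * gauss_density x + K * expR (- x).
pose F x := - (hermite q x * gauss_density x) - K * expR (- x).
have dF x : is_derive x 1 F (f x).
  have ? := is_derive_hermite_gauss q x.
  rewrite (_ : F = - (fun x => hermite q x * gauss_density x) - (K *: (expR \o -%R))) //.
  by apply: is_derive_eq; rewrite /GRing.scale /= /f; ring.
have cF x : {for x, continuous F}.
  by apply: differentiable_continuous; apply/derivable1_diffP; have [] := dF x.
have fint : (\int[mu]_(x in `[u, +oo[) (f x)%:E = (- F u)%:E)%E.
  rewrite (@ge0_continuous_FTC2y R _ F u 0).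
  - by rewrite -EFinB sub0r.
  - move=> x _; rewrite /f -lerBlDr sub0r.
    have := HK x; rewrite ler_norml => /andP[h _]; apply: le_trans h.
    by rewrite lerN2 ler_wpM2l // ler_expR lerN2 ler_norm.
  - apply: continuous_subspaceT => x.
    by apply: cvgD; [exact: continuous_hermite_gauss|exact: continuous_mul_expRN].
  - rewrite -[0]subr0 -[X in _ --> X - _]oppr0 /F.
    have e0 c : c * expR (- x) @[x --> +oo%R] --> (0 : R).
      by rewrite -[X in _ --> X](mulr0 c); apply: cvgMl_tmp; exact: cvgr_expR.
    apply: cvgB; last exact: e0.
    apply: cvgN; apply/cvgr0Pnorm_le => e e_gt0.
    have /cvgr0Pnorm_le/(_ _ e_gt0) := e0 K'.
    move=> H; near=> x.
    have x0 : 0 <= x by near: x; exact: nbhs_pinfty_ge.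
    have := HK' x; rewrite (ger0_norm x0) => /le_trans; apply.
    by apply: (le_trans (ler_norm _)); near: x.
  - by move=> x _; have [] := dF x.
  - exact/cvg_at_right_filter/cF.
  - by move=> x _; rewrite derive1E; have [_ ->] := dF x.
have : (\int[mu]_(x in `[u, +oo[) (f x)%:E =
  \int[mu]_(x in `[u, +oo[) (hermite q.+1 x * gauss_density x)%:E +
  \int[mu]_(x in `[u, +oo[) (K * expR (- x))%:E)%E.
  rewrite -integralD_EFin //; first exact: integrable_hermite_gauss.
  exact: integrable_expRN.
rewrite fint integral_expRN //.
have : (\int[mu]_(x in `[u, +oo[) (hermite q.+1 x * gauss_density x)%:E)%E
  \is a fin_num.
  by apply: integrable_fin_num => //; exact: integrable_hermite_gauss.
move=> Ifin; rewrite -(fineK Ifin) -EFinD => -[h].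
by apply/eqP; rewrite eqe; apply/eqP; move: h; rewrite /F; lra.
Unshelve. all: by end_near. Qed.

Lemma hermite_coef_indic u q :
  hermite_coef (fun z => if u <= z then 1 else 0) q =
  ((q`!%:R^-1)%:E * \int[mu]_(x in `[u, +oo[) (hermite q x * gauss_density x)%:E)%E.
Proof.
rewrite /hermite_coef; congr (_ * _)%E.
rewrite [RHS]integral_mkcond; apply: eq_integral => x _.
rewrite patchE; case: ifPn => [ux|ux].
  by rewrite mulr1 mem_set // /= in_itv /= ux.
by rewrite memNset ?mulr0 ?mul0r //= in_itv /= andbT; exact/negP.
Qed.

(** This includes [q = 0], where the coefficient is a Gaussian tail and the boundary formula of
    [hermite_coef_indicS] does not apply. *)
Lemma hermite_coef_fin_num u q :
  hermite_coef (fun z => if u <= z then 1 else 0) q \is a fin_num.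
Proof.
rewrite hermite_coef_indic fin_numM //.
by apply: integrable_fin_num => //; exact: integrable_hermite_gauss.
Qed.

Lemma hermite_coef_indicS u q :
  hermite_coef (fun z => if u <= z then 1 else 0) q.+1 =
  (hermite q u * gauss_density u / q.+1`!%:R)%:E.
Proof.
by rewrite hermite_coef_indic integral_hermite_gauss -EFinM mulrC.
Qed.

End hermite_integral.

(** * The covariance function *)

Section tuple_vectors.
Variables (R : realType) (d : nat).
Implicit Types (x y : d.-tuple R) (a b : R).

Definition tscale a x : d.-tuple R := [tuple a * tnth x i | i < d].

Lemma tscale0 x : tscale 0 x = tzero R d.
Proof. by apply/eq_from_tnth => i; rewrite !tnth_mktuple mul0r. Qed.

Lemma tscale1 x : tscale 1 x = x.
Proof. by apply/eq_from_tnth => i; rewrite !tnth_mktuple mul1r. Qed.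

Lemma tscaleA a b x : tscale a (tscale b x) = tscale (a * b) x.
Proof. by apply/eq_from_tnth => i; rewrite !tnth_mktuple mulrA. Qed.

Lemma tsub_scale a b x : tsub (tscale a x) (tscale b x) = tscale (a - b) x.
Proof. by apply/eq_from_tnth => i; rewrite !tnth_mktuple mulrBl. Qed.

Lemma tsub0 x : tsub (tzero R d) x = tscale (-1) x.
Proof. by apply/eq_from_tnth => i; rewrite !tnth_mktuple sub0r mulN1r. Qed.

Lemma enorm_ge0 x : 0 <= enorm x. Proof. exact: sqrtr_ge0. Qed.

Lemma enorm_scale a x : enorm (tscale a x) = `|a| * enorm x.
Proof.
rewrite /enorm -sqrtr_sqr -sqrtrM ?sqr_ge0 // mulr_sumr.
by congr Num.sqrt; apply: eq_bigr => i _; rewrite tnth_mktuple exprMn.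
Qed.

Lemma enorm0 : enorm (tzero R d) = 0.
Proof. by rewrite -(tscale0 (tzero R d)) enorm_scale normr0 mul0r. Qed.

Lemma enorm_coord x i : `|tnth x i| <= enorm x.
Proof.
rewrite -sqrtr_sqr ler_sqrt ?sumr_ge0 // => [|j _]; last exact: sqr_ge0.
by rewrite (bigD1 i) //= lerDl sumr_ge0 // => j _; exact: sqr_ge0.
Qed.

Lemma enorm_le x a : (forall i, `|tnth x i| <= a) -> enorm x <= d%:R * a.
Proof.
move=> xa; case: (posnP d) => [d0|d0].
  have -> : enorm x = 0.
    rewrite /enorm big1 ?sqrtr0 // => i _; exfalso.
    by have := leq_ltn_trans (leq0n i) (ltn_ord i); rewrite d0.
  by rewrite d0 mul0r.
have a0 : 0 <= a by apply: le_trans (xa (Ordinal d0)).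
have da0 : 0 <= d%:R * a by rewrite mulr_ge0.
rewrite -(ger0_norm da0) -sqrtr_sqr ler_sqrt ?sqr_ge0 //.
apply: (@le_trans _ _ (\sum_(i < d) a ^+ 2)).
  apply: ler_sum => i _; rewrite -(real_normK (num_real _)).
  by rewrite ler_sqr ?nnegrE.
rewrite sumr_const card_ord -[leLHS]mulr_natl exprMn ler_wpM2r ?sqr_ge0 //.
by rewrite expr2 -natrM ler_nat leq_pmull.
Qed.

End tuple_vectors.

Section elementary_bounds.
Variable R : realType.

Lemma bernoulli_le (t : R) q : 0 <= t <= 1 -> 1 - q%:R * t <= (1 - t) ^+ q.
Proof.
move=> /andP[t0 t1]; elim: q => [|q IH]; first by rewrite mul0r subr0.
rewrite exprS; apply: le_trans (ler_wpM2l _ IH); last by rewrite subr_ge0.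
rewrite -[q.+1%:R]natr1.
have : 0 <= q%:R * t * t by rewrite !mulr_ge0.
nra.
Qed.

Lemma powRrVK (a s : R) : 0 <= a -> s != 0 -> (a `^ s^-1) `^ s = a.
Proof. by move=> a0 s0; rewrite -powRrM mulVf // powRr1. Qed.

(** With [m >= n / alpha] and [y = s^alpha], one has [s^n <= y^m] for [s > 1], while
    [exp(c y) = exp(c y / m)^m >= (c y / m)^m]. The summand 1 of the constant serves [s <= 1]. *)
Lemma expRN_powR_bound (c alpha : R) n : 0 < c -> 0 < alpha ->
  exists2 A, 0 < A & forall s : R, 0 < s -> s ^+ n * expR (- (c * s `^ alpha)) <= A.
Proof.
move=> c0 a0; pose m := (Num.trunc (n%:R / alpha)).+1.
have m0 : 0 < m%:R :> R by rewrite ltr0n.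
have nm : n%:R <= alpha * m%:R.
  rewrite mulrC -ler_pdivrMr //; apply: ltW; exact: truncnS_gt.
exists (1 + (m%:R / c) ^+ m).
  by rewrite ltr_pwDl // exprn_ge0 // divr_ge0 // ltW.
move=> s s0; set y := s `^ alpha.
have y0 : 0 <= y by exact: powR_ge0.
have cy0 : 0 <= c * y by rewrite mulr_ge0 // ltW.
have [s1|s1] := leP s 1.
  apply: (@le_trans _ _ 1); last by rewrite lerDl exprn_ge0 // divr_ge0 // ltW.
  rewrite -[leRHS]mulr1 ler_pM ?exprn_ge0 ?expR_ge0 ?(ltW s0) //.
    by rewrite exprn_ile1 // ltW.
  by rewrite -expR0 ler_expR oppr_le0.
apply: (@le_trans _ _ ((m%:R / c) ^+ m)); last by rewrite lerDr.
rewrite expRN ler_pdivrMr ?expR_gt0 //.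
apply: (@le_trans _ _ (y ^+ m)).
  rewrite -!powR_mulrn ?(ltW s0) // /y -powRrM; apply: ler_powR => //; exact: ltW.
have -> : c * y = m%:R * (c * y / m%:R) by field; rewrite gt_eqF.
rewrite expRM_natl -exprMn lerXn2r ?nnegrE //.
  by rewrite mulr_ge0 ?expR_ge0 // divr_ge0 // ltW.
have -> : y = m%:R / c * (c * y / m%:R) by field; rewrite !gt_eqF.
rewrite ler_wpM2l ?divr_ge0 ?(ltW c0) ?(ltW m0) //.
have -> : c * (m%:R / c * (c * y / m%:R)) / m%:R = c * y / m%:R.
  by field; rewrite !gt_eqF.
by apply: le_trans (expR_ge1Dx _); rewrite lerDr.
Qed.

End elementary_bounds.

Section covariance.
Variables (R : realType) (d : nat) (C : d.-tuple R -> R).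
Hypothesis C_pd : pos_def_fun C.
Hypothesis C0 : C (tzero R d) = 1.

(** This is the quadratic form of the three points [0, x, 2x]; by evenness only [C(x)] and [C(2x)]
    occur in it. *)
Lemma pos_def_progression x (a b c : R) :
  0 <= a ^+ 2 + b ^+ 2 + c ^+ 2 + 2 * (a * b + b * c) * C x
       + 2 * a * c * C (tscale 2 x).
Proof.
have CN y : C (tscale (-1) y) = C y by rewrite -tsub0 C_pd.1.
have := C_pd.2 3 (fun i : 'I_3 => tscale i%:R x) (fun i : 'I_3 => [:: a; b; c]`_i).
rewrite !big_ord_recr !big_ord0 /= !add0r !tsub_scale ?mulr0n ?mulr1n.
rewrite (_ : (1 + 1)%R = 2%N) //.
have -> : 0 - 0 = 0 :> R by ring.
have -> : 0 - 1 = -1 :> R by ring.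
have -> : 0 - 2 = -1 * 2 :> R by ring.
have -> : 1 - 0 = 1 :> R by ring.
have -> : 1 - 1 = 0 :> R by ring.
have -> : 1 - 2 = -1 :> R by ring.
have -> : 2 - 0 = 2 :> R by ring.
have -> : 2 - 1 = 1 :> R by ring.
have -> : 2 - 2 = 0 :> R by ring.
rewrite -tscaleA !CN tscale0 tscale1 C0 => h.
by apply: (le_trans h); rewrite le_eqVlt; apply/orP; left; apply/eqP; ring.
Qed.

Lemma cov_norm_le1 x : `|C x| <= 1.
Proof.
have := pos_def_progression x 1 1 0; have := pos_def_progression x 1 (-1) 0.
by rewrite ler_norml => h1 h2; apply/andP; split; lra.
Qed.

(** The weights [1, -2 C(y), 1], optimal in the middle one, give [C(2y) >= 2 C(y)^2 - 1]. Hence [1 -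
    |C(2y)| <= 2 (1 - |C(y)|)(1 + |C(y)|) <= 4 (1 - |C(y)|)], and this is iterated. *)
Lemma cov_doubling k x :
  1 - `|C (tscale (2 ^+ k) x)| <= 4 ^+ k * (1 - `|C x|).
Proof.
elim: k => [|k IH]; first by rewrite !expr0 tscale1 mul1r.
rewrite !exprS -mulrA -tscaleA; set y := tscale (2 ^+ k) x in IH *.
have h := pos_def_progression y 1 (- 2 * C y) 1.
have := cov_norm_le1 y; have := ler_norm (C (tscale 2 y)).
have := real_normK (num_real (C y)).
have := normr_ge0 (C y); nra.
Qed.

Section bounds.
Variables (alpha C1 C2 C3 delta eps : R).
Hypothesis alpha0 : 0 < alpha.
Hypothesis C10 : 0 < C1.
Hypothesis C20 : 0 < C2.
Hypothesis C30 : 0 < C3.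
Hypothesis delta0 : 0 < delta.
Hypothesis eps0 : 0 < eps.
Hypothesis C_decay : forall x : d.-tuple R, x != tzero R d ->
  `|C x| <= C1 * enorm x `^ (- delta).
Hypothesis C_near0 : forall x : d.-tuple R, enorm x <= eps ->
  C2 * enorm x `^ alpha <= 1 - C x <= C3 * enorm x `^ alpha.

(* If |C x| were close to 1 then, by doubling, so would |C (2^k x)| be,
   against the decay at infinity. *)
Lemma cov_gap r : 0 < r -> exists2 eta, 0 < eta <= 1 &
  forall x, r <= enorm x -> `|C x| <= 1 - eta.
Proof.
move=> r0.
(* Beyond norm [(2 C1)^(1/delta)] the decay hypothesis gives [|C| <= 1/2]. Reaching it takes [k]
   doublings at a cost of [4^k], whence [eta = 1 / (2 * 4^k)]. *)
have [k kr] : exists k, (2 * C1) `^ delta^-1 <= 2 ^+ k * r.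
  exists (Num.trunc ((2 * C1) `^ delta^-1 / r)).+1.
  rewrite -ler_pdivrMr //; apply/ltW/(lt_trans (truncnS_gt _)).
  by rewrite -natrX ltr_nat ltn_expl.
have p40 : 0 < 2 * 4 ^+ k :> R by rewrite mulr_gt0 // exprn_gt0.
exists (2 * 4 ^+ k)^-1.
  rewrite invr_gt0 p40 invf_le1 //=.
  apply: (@le_trans _ _ (2 * 1)); first by lra.
  by rewrite ler_wpM2l // exprn_ege1 //; lra.
move=> x rx; have x0 : 0 < enorm x by apply: lt_le_trans rx.
have := cov_doubling k x; set y := tscale _ x.
have ny : enorm y = 2 ^+ k * enorm x by rewrite enorm_scale ger0_norm ?exprn_ge0.
have y0 : 0 < enorm y by rewrite ny mulr_gt0 // exprn_gt0.
have yn0 : y != tzero R d.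
  by apply: contraTneq y0 => ->; rewrite enorm0 ltxx.
have Cy : `|C y| <= 2^-1.
  apply: (le_trans (C_decay yn0)).
  rewrite powRN ler_pdivrMr ?powR_gt0 //.
  rewrite -ler_pdivrMl ?invr_gt0 // invrK.
  rewrite -[leLHS](@powRrVK _ _ delta) ?gt_eqF ?mulr_ge0 ?(ltW C10) //.
  apply: ge0_ler_powR; rewrite ?nnegrE ?powR_ge0 ?(ltW y0) ?(ltW delta0) //.
  apply: (le_trans kr); rewrite ny ler_wpM2l // exprn_ge0 //.
move=> h.
have : 2^-1 <= 4 ^+ k * (1 - `|C x|) by lra.
rewrite mulrC -ler_pdivrMr ?exprn_gt0 // -invfM; lra.
Qed.

Lemma cov_near : exists2 r, 0 < r & forall x, enorm x <= r ->
  C2 * enorm x `^ alpha <= 1 - C x <= C3 * enorm x `^ alpha /\ 2^-1 <= C x.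
Proof.
exists (Num.min eps ((2 * C3)^-1 `^ alpha^-1)).
  by rewrite lt_min eps0 powR_gt0 // invr_gt0 mulr_gt0.
move=> x; rewrite le_min => /andP[xe xr]; have h := C_near0 xe; split => //.
have : enorm x `^ alpha <= (2 * C3)^-1.
  rewrite -[leRHS](@powRrVK _ _ alpha) ?gt_eqF ?invr_ge0 ?mulr_ge0 ?(ltW C30) //.
  by apply: ge0_ler_powR; rewrite ?nnegrE ?powR_ge0 ?enorm_ge0 ?(ltW alpha0).
rewrite invfM ler_pdivlMr // mulrC => h2.
move: h => /andP[_]; lra.
Qed.

(** Both regimes fit one bound through [1 - t <= exp(-t)]: near the origin [t] is controlled by
    [C2], and farther out the gap [eta] exceeds [c |x|^alpha] because the norm stays below [D].
    Differences of points of the bounded set [E] do stay in such a range. *)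
Lemma cov_exp_bound D : 0 < D -> exists2 c, 0 < c &
  forall x, enorm x <= D -> `|C x| <= expR (- (c * enorm x `^ alpha)).
Proof.
move=> D0; have [r r0 Hr] := cov_near; have [eta /andP[eta0 eta1] Heta] := cov_gap r0.
have Da : 0 < D `^ alpha by exact: powR_gt0.
exists (Num.min C2 (eta / D `^ alpha)); first by rewrite lt_min C20 divr_gt0.
set c := Num.min _ _.
have cC : c <= C2 by rewrite ge_min lexx.
have cD : c * D `^ alpha <= eta by rewrite -ler_pdivlMr // ge_min lexx orbT.
have c0 : 0 <= c by rewrite le_min (ltW C20) divr_ge0 // ltW.
move=> x xD; apply: le_trans (expR_ge1Dx _).
have [xr|/ltW rx] := leP (enorm x) r.
  have [/andP[h1 h2] h3] := Hr _ xr.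
  rewrite ger0_norm; last by lra.
  have : c * enorm x `^ alpha <= C2 * enorm x `^ alpha.
    by rewrite ler_wpM2r // powR_ge0.
  lra.
have : c * enorm x `^ alpha <= c * D `^ alpha.
  by rewrite ler_wpM2l // ge0_ler_powR ?nnegrE ?enorm_ge0 ?(ltW alpha0) ?(ltW D0).
have := Heta _ rx; lra.
Qed.

(** Measured in units of [q^(-1/alpha)], the exponent [q |x|^alpha] is at least [s^alpha], so the
    decay in [s] beats every power, uniformly in [q]. The application takes [n = d.+1], one more
    than the dimension. *)
Lemma cov_pow_upper D n : 0 < D -> exists2 A, 0 < A &
  forall (q : nat) x s, (0 < q)%N -> enorm x <= D -> 0 < s ->
    s * q%:R `^ (- alpha^-1) <= enorm x -> `|C x| ^+ q <= A / s ^+ n.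
Proof.
move=> D0; have [c c0 Hc] := cov_exp_bound D0.
have [A A0 HA] := @expRN_powR_bound R c alpha n c0 alpha0.
exists A => // q x s q0 xD s0 sx.
rewrite ler_pdivlMr ?exprn_gt0 // mulrC; apply: le_trans (HA _ s0).
rewrite ler_wpM2l ?exprn_ge0 ?(ltW s0) //.
have qp : 0 < q%:R :> R by rewrite ltr0n.
apply: (@le_trans _ _ (expR (- (c * enorm x `^ alpha)) ^+ q)).
  by rewrite lerXn2r ?nnegrE ?expR_ge0 //; exact: Hc.
rewrite -expRM_natl ler_expR mulrN lerN2 mulrCA ler_wpM2l ?(ltW c0) //.
have -> : s `^ alpha = q%:R * (s * q%:R `^ (- alpha^-1)) `^ alpha.
  rewrite powRM ?powR_ge0 ?(ltW s0) // -powRrM mulNr mulVf ?gt_eqF //.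
  by rewrite powR_inv1 // mulrCA divff ?mulr1 // gt_eqF.
rewrite ler_wpM2l // ge0_ler_powR ?nnegrE ?enorm_ge0 ?(ltW alpha0) //.
by rewrite mulr_ge0 ?powR_ge0 // ltW.
Qed.

(** Away from the origin an odd power may be negative, but the gap makes it geometrically small. The
    constant [k] is chosen so that [C3 |x|^alpha <= 1/(2q)] on the core; Bernoulli then gives
    [C^q >= (1 - 1/(2q))^q >= 1/2]. The threshold on [q] places the core inside the radius of
    [cov_near]. *)
Lemma cov_pow_lower : exists (k rho : R) (N : nat), 0 < k /\ 0 <= rho < 1 /\
  forall (q : nat) x, (N < q)%N ->
    - rho ^+ q <= C x ^+ q /\
    (enorm x <= k * q%:R `^ (- alpha^-1) -> 2^-1 <= C x ^+ q).
Proof.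
have [r r0 Hr] := cov_near; have [eta /andP[eta0 eta1] Heta] := cov_gap r0.
pose k := (2 * C3)^-1 `^ alpha^-1.
have k0 : 0 < k by rewrite powR_gt0 // invr_gt0 mulr_gt0.
exists k, (1 - eta), (Num.trunc ((k / r) `^ alpha)); split => //; split.
  by apply/andP; split; lra.
move=> q x qN; have qp : 0 < q%:R :> R by rewrite ltr0n (leq_ltn_trans _ qN).
split.
  have [xr|/ltW rx] := leP (enorm x) r.
    have [_ h] := Hr _ xr; apply: (@le_trans _ _ 0).
      by rewrite oppr_le0 exprn_ge0 //; lra.
    by rewrite exprn_ge0 //; lra.
  apply: (@le_trans _ _ (- `|C x ^+ q|)); last by have := ler_normr; rewrite lerNl -normrN ler_norm.
  rewrite lerN2 normrX lerXn2r ?nnegrE //; first by lra.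
  exact: Heta.
move=> xk.
have kqr : k * q%:R `^ (- alpha^-1) <= r.
  rewrite powRN ler_pdivrMr ?powR_gt0 // mulrC -ler_pdivrMr //.
  have kr0 : 0 <= k / r by rewrite divr_ge0 // ltW.
  rewrite -[leLHS](@powRrVK _ _ alpha^-1) ?invr_eq0 ?gt_eqF // invrK.
  rewrite ge0_ler_powR ?nnegrE ?powR_ge0 ?invr_ge0 ?(ltW alpha0) //.
  by apply/ltW/(lt_le_trans (truncnS_gt _)); rewrite ler_nat.
have [/andP[_ h1] h2] := Hr _ (le_trans xk kqr).
have xa : enorm x `^ alpha <= (2 * C3)^-1 / q%:R.
  apply: (@le_trans _ _ ((k * q%:R `^ (- alpha^-1)) `^ alpha)).
    by rewrite ge0_ler_powR ?nnegrE ?mulr_ge0 ?enorm_ge0 ?powR_ge0 ?(ltW alpha0).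
  rewrite powRM ?powR_ge0 // powRrVK ?gt_eqF ?invr_ge0 ?mulr_ge0 ?(ltW C30) //.
  by rewrite -powRrM mulNr mulVf ?gt_eqF // powR_inv1.
pose t : R := (2 * q%:R)^-1.
have t0 : 0 <= t by rewrite invr_ge0 mulr_ge0.
have qt : q%:R * t = 2^-1 by rewrite /t; field; rewrite gt_eqF.
have t1 : t <= 1.
  have : 1 <= q%:R :> R by rewrite ler1n (leq_ltn_trans _ qN).
  nra.
have Ct : 1 - t <= C x.
  have : C3 * enorm x `^ alpha <= t.
    rewrite (_ : t = C3 * ((2 * C3)^-1 / q%:R)) ?ler_wpM2l ?(ltW C30) //.
    by rewrite /t; field; rewrite !gt_eqF.
  lra.
apply: (@le_trans _ _ ((1 - t) ^+ q)).
  apply: le_trans (bernoulli_le _ _); first by rewrite qt; lra.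
  by apply/andP.
by rewrite lerXn2r ?nnegrE //; lra.
Qed.

End bounds.
End covariance.

(** * Integrals of powers of the covariance *)

Section measurability.
Variables (R : realType) (d : nat).
Implicit Types (x y : d.-tuple R).

Lemma measurable_tuple_box (P : 'I_d -> set R) : (forall i, measurable (P i)) ->
  measurable [set x : d.-tuple R | forall i, P i (tnth x i)].
Proof.
move=> mP.
rewrite (_ : [set x | _] = \bigcap_(i in [set: 'I_d]) ((fun x : d.-tuple R => tnth x i) @^-1` P i)).
  apply: fin_bigcap_measurable => // i _.
  by rewrite -[X in measurable X]setTI; exact: measurable_tnth.
by apply/seteqP; split => x /= H i; [move=> _; exact: H|exact: (H i I)].
Qed.

Lemma nbhs_rat_itv (a : R) (P : set R) : nbhs a P ->
  exists q : rat * rat, ratr q.1 < a < ratr q.2 /\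
    forall b : R, ratr q.1 < b < ratr q.2 -> P b.
Proof.
move=> /nbhs_ballP [e /= e0 Pe].
have [p] := @rat_in_itvoo R (a - e) a ltac:(lra).
have [q] := @rat_in_itvoo R a (a + e) ltac:(lra).
rewrite !in_itv /= => /andP[q1 q2] /andP[p1 p2].
exists (p, q) => /=; split; first by rewrite p2 q1.
move=> b /andP[b1 b2]; apply: Pe; rewrite /ball /= ltr_norml; apply/andP; split; lra.
Qed.

(** The topology lives on row vectors and the sigma-algebra on tuples. They are linked by writing an
    open set as the countable union of the rational boxes it contains; boxes not contained in it are
    replaced by the empty set. *)
Lemma measurable_open_tuple (U : set 'rV[R]_d) : open U ->
  measurable (@t2rv R d @^-1` U).
Proof.
move=> oU.
pose B (q : {ffun 'I_d -> rat * rat}) : set (d.-tuple R) :=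
  [set x | forall i, [set b : R | ratr (q i).1 < b < ratr (q i).2] (tnth x i)].
pose F q := if `[< B q `<=` @t2rv R d @^-1` U >] then B q else set0.
rewrite (_ : _ @^-1` _ = \bigcup_q F q).
  apply: countable_bigcupT_measurable => [|q]; first exact: countableP.
  rewrite /F; case: ifP => // _.
  apply: (@measurable_tuple_box (fun i => [set b : R | ratr (q i).1 < b < ratr (q i).2])) => i.
  rewrite (_ : [set b | _] = `]ratr (q i).1, ratr (q i).2[%classic) //.
apply/seteqP; split => [x Ux|x [q _]]; last first.
  by rewrite /F; case: asboolP => // + Bx; apply.
have [P Px PU] : nbhs (t2rv x) U by exact: open_nbhs_nbhs.
have H i : exists q : rat * rat, ratr q.1 < tnth x i < ratr q.2 /\
   forall b : R, ratr q.1 < b < ratr q.2 -> P 0 i b.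
  by apply: nbhs_rat_itv; have := Px 0 i; rewrite mxE.
have [q Hq] := fin_all_exists H.
exists (finfun q) => //; rewrite /F; case: asboolP => [_ i|]; rewrite ?ffunE.
  by have [] := Hq i.
case=> y By; apply: PU => a i; rewrite (ord1 a) mxE.
by have [_] := Hq i; apply; have := By i; rewrite /= ffunE.
Qed.

Lemma measurable_continuous_tuple (f : d.-tuple R -> R) :
  continuous (fun v : 'rV[R]_d => f (rv2t v)) -> measurable_fun setT f.
Proof.
move=> cf; apply: (measurability (@RGenOInfty.G R) (RGenOInfty.measurableE R)) => _ [_ [a ->] <-].
rewrite setTI.
rewrite (_ : _ @^-1` _ = @t2rv R d @^-1` ((fun v => f (rv2t v)) @^-1` `]a, +oo[)).
  apply: measurable_open_tuple; apply: open_comp => // v _; exact: cf.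
apply/seteqP; split => x /=; rewrite (_ : rv2t (t2rv x) = x) //.
all: by apply/eq_from_tnth => i; rewrite tnth_mktuple mxE.
Qed.

Lemma measurable_tsub : measurable_fun setT
  (fun z : d.-tuple R * d.-tuple R => tsub z.1 z.2).
Proof.
apply/measurable_fun_tnthP => i.
rewrite (_ : _ \o _ = fun z => tnth z.1 i - tnth z.2 i).
  apply: measurable_funB.
    exact: (measurableT_comp (measurable_tnth i) measurable_fst).
  exact: (measurableT_comp (measurable_tnth i) measurable_snd).
by apply/funext => z /=; rewrite tnth_mktuple.
Qed.

Lemma compact_tuple_bounded (E : set (d.-tuple R)) : compact (@t2rv R d @` E) ->
  exists2 M, 0 < M & forall x, E x -> forall i, `|tnth x i| <= M.
Proof.
move=> cE.
have H i : exists M : R, forall x, E x -> `|tnth x i| <= M.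
  have : compact ((fun v : 'rV[R]_d => v 0 i) @` (@t2rv R d @` E)).
    apply: continuous_compact => //; apply: continuous_subspaceT.
    exact: coord_continuous.
  move=> /compact_bounded [M [_ HM]]; exists (M + 1) => x Ex.
  apply: (HM (M + 1)); first by rewrite ltrDl.
  by exists (t2rv x); [exists x|rewrite mxE].
have [M HM] := fin_all_exists H.
exists (1 + \sum_i `|M i|); first by rewrite ltr_pwDl // sumr_ge0.
move=> x Ex i; apply: (le_trans (HM i x Ex)); apply: (le_trans (ler_norm _)).
by rewrite (bigD1 i) //= addrCA lerDl addr_ge0 // sumr_ge0.
Qed.

End measurability.

Lemma measurable_compact_tuple (R : realType) d (E : set (d.+1.-tuple R)) :
  compact (@t2rv R d.+1 @` E) -> measurable E.
Proof.
move=> cE; have clE : closed (@t2rv R d.+1 @` E).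
  exact: (compact_closed (@norm_hausdorff _ _)).
rewrite (_ : E = ~` (@t2rv R d.+1 @^-1` (~` (@t2rv R d.+1 @` E)))).
  by apply: measurableC; apply: measurable_open_tuple; exact: closed_openC.
rewrite preimage_setC setCK; apply/seteqP; split => x /=; first by exists x.
move=> [y Ey /rowP yx]; suff -> : x = y by [].
by apply/eq_from_tnth => i; have := yx i; rewrite !mxE.
Qed.

Section sigma_finite_integral.
Context d1 d2 (T1 : measurableType d1) (T2 : measurableType d2) (R : realType).
Variable mu : {measure set T2 -> \bar R}.
Hypothesis sf : sigma_finite setT mu.

(** [mu] is given as a bare measure whose sigma-finiteness is a derived fact, so it is repackaged
    before Fubini-Tonelli is applied. *)
Lemma measurable_fun_integral_sigma_finite (f : T1 * T2 -> \bar R) :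
  measurable_fun setT f -> (forall z, 0 <= f z)%E ->
  measurable_fun setT (fun x => \int[mu]_y f (x, y))%E.
Proof.
pose m : {sigma_finite_measure set T2 -> \bar R} :=
  HB.pack_for (SigmaFiniteMeasure.type T2 R) (Measure.sort mu)
    (isSFinite.Build _ _ _ _ (sfinite_measure_sigma_finite sf))
    (isSigmaFinite.Build _ _ _ _ sf).
exact: (@measurable_fun_fubini_tonelli_F _ _ _ _ _ m).
Qed.

End sigma_finite_integral.

Section finite_domain.
Context dT (T : measurableType dT) (R : realType).
Variables (mu : {measure set T -> \bar R}) (E : set T).
Hypothesis mE : measurable E.
Hypothesis muE : (mu E < +oo)%E.

Lemma bounded_integrable (f : T -> R) (B : R) : measurable_fun E f ->
  (forall x, E x -> `|f x| <= B) -> mu.-integrable E (EFin \o f).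
Proof.
move=> mf fB; apply: (@le_integrable _ _ _ mu _ mE _ (EFin \o cst B)).
- exact/measurable_EFinP.
- by move=> x Ex; rewrite lee_fin (le_trans (fB x Ex)) // ler_norm.
- apply/integrableP; split; first exact/measurable_EFinP.
  by rewrite (eq_integral (cst `|B|%:E)) // integral_cst // lte_mul_pinfty.
Qed.

Lemma integral_fin_sum_indic (I : finType) (Q : I -> set T) (a : I -> R) :
  (forall i, measurable (Q i)) -> (forall i, 0 <= a i) ->
  (\int[mu]_(x in E) (\sum_i a i * \1_(Q i) x)%:E =
   (\sum_i a i * fine (mu (Q i `&` E)))%:E)%E.
Proof.
move=> mQ a0; under eq_integral do rewrite -sumEFin.
have m1 i : measurable_fun E (fun x => (\1_(Q i) x : R)).
  by apply: measurable_funTS; exact: measurable_indic.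
rewrite ge0_integral_sum //; first last.
- by move=> i x _; rewrite lee_fin mulr_ge0.
- by move=> i; apply/measurable_EFinP; apply: measurable_funM.
rewrite -sumEFin; apply: eq_bigr => i _.
under eq_integral do rewrite EFinM.
rewrite ge0_integralZl_EFin //; last exact/measurable_EFinP.
rewrite integral_indic // EFinM fineK // ge0_fin_numE //.
by apply: le_lt_trans muE; apply: le_measure; rewrite ?inE //; exact: measurableI.
Qed.

End finite_domain.

(** Cauchy-Schwarz, from the squared deviations around [S / N]. [N] is only a real upper bound of
    the cardinality, so the cells of a grid need not be counted exactly. *)
Lemma sum_sqr_ge (R : realType) (I : finType) (m : I -> R) (N : R) :
  0 < N -> #|I|%:R <= N -> (\sum_i m i) ^+ 2 / N <= \sum_i m i ^+ 2.
Proof.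
move=> N0 IN; set S := \sum_i m i; pose a := S / N.
have aN : a * N = S by rewrite /a mulfVK // gt_eqF.
have : 0 <= \sum_i (m i - a) ^+ 2 by apply: sumr_ge0 => i _; exact: sqr_ge0.
have -> : \sum_i (m i - a) ^+ 2 = \sum_i m i ^+ 2 - 2 * a * S + #|I|%:R * a ^+ 2.
  transitivity (\sum_i (m i ^+ 2 + (- (2 * a) * m i + a ^+ 2))).
    by apply: eq_bigr => i _; ring.
  rewrite !big_split /= -mulr_sumr sumr_const -mulr_natl -/S; ring.
have h : #|I|%:R * a ^+ 2 <= N * a ^+ 2 by rewrite ler_wpM2r // sqr_ge0.
have -> : S ^+ 2 / N = a * S by rewrite /a expr2; ring.
have e : N * a ^+ 2 = a * S by rewrite -aN; ring.
rewrite e in h; lra.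
Qed.

Section lebesgue_Rd.
Variables (R : realType) (d : nat) (mu : {measure set (d.-tuple R) -> \bar R}).
Hypothesis mu_lebesgue : is_lebesgue_Rd mu.

(** A sup-norm ball: being a cube, it has its measure given directly by [is_lebesgue_Rd]. *)
Definition tball (x : d.-tuple R) (r : R) : set (d.-tuple R) :=
  [set y | forall i, tnth x i - r <= tnth y i <= tnth x i + r].

Lemma measurable_tball x r : measurable (tball x r).
Proof.
apply: (@measurable_tuple_box _ _ (fun i => [set b | tnth x i - r <= b <= tnth x i + r])) => i.
by rewrite -set_itvcc.
Qed.

Lemma measure_tball x r : 0 <= r -> mu (tball x r) = ((2 * r) ^+ d)%:E.
Proof.
move=> r0.
have := @mu_lebesgue [tuple tnth x i - r | i < d] [tuple tnth x i + r | i < d].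
move=> /(_ _)/wrap[].
  by move=> i; rewrite !tnth_mktuple; lra.
rewrite (_ : [set y | _] = tball x r); last first.
  by apply/seteqP; split => y /= H i; have := H i; rewrite !tnth_mktuple.
move=> ->; congr EFin.
rewrite (eq_bigr (fun=> 2 * r)) => [|i _]; first by rewrite prodr_const card_ord.
rewrite !tnth_mktuple; ring.
Qed.

Lemma lebesgue_Rd_sigma_finite : sigma_finite setT mu.
Proof.
exists (fun n => tball (tzero R d) n%:R); last first.
  move=> n; split; first exact: measurable_tball.
  by rewrite measure_tball // ltry.
apply/seteqP; split => // x _; exists (Num.trunc (\sum_i `|tnth x i|)).+1 => //= i.
rewrite tnth_mktuple sub0r add0r -ler_norml.
apply: le_trans (ltW (truncnS_gt _)); rewrite (bigD1 i) //= lerDl.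
by rewrite sumr_ge0.
Qed.

Lemma subset_tball (E : set (d.-tuple R)) (M : R) :
  (forall x, E x -> forall i, `|tnth x i| <= M) -> E `<=` tball (tzero R d) M.
Proof. by move=> EM x Ex i; rewrite tnth_mktuple sub0r add0r -ler_norml EM. Qed.

End lebesgue_Rd.

(** * Upper and lower bounds for the double integral of [C(x - y)^q] *)

Section covariance_power_integral.
Variables (R : realType) (d : nat) (C : d.-tuple R -> R).
Variables (mu : {measure set (d.-tuple R) -> \bar R}) (E : set (d.-tuple R)) (M : R).
Hypothesis mC : measurable_fun setT C.
Hypothesis C1 : forall x, `|C x| <= 1.
Hypothesis mu_lebesgue : is_lebesgue_Rd mu.
Hypothesis mE : measurable E.
Hypothesis M0 : 0 < M.
Hypothesis EM : forall x, E x -> forall i, `|tnth x i| <= M.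
Implicit Types (x y : d.-tuple R) (q : nat).

Lemma bounded_measure_lty : (mu E < +oo)%E.
Proof.
apply: (@le_lt_trans _ _ (mu (tball (tzero R d) M))).
  by apply: le_measure; rewrite ?inE; [|exact: measurable_tball|exact: subset_tball].
by rewrite measure_tball ?ltry // ltW.
Qed.

Local Lemma muE_fineK : (fine (mu E))%:E = mu E.
Proof. by rewrite fineK // ge0_fin_numE // bounded_measure_lty. Qed.

Let f q x y : R := C (tsub x y) ^+ q.

Local Lemma f_bound q x y : `|f q x y| <= 1.
Proof. by rewrite normrX exprn_ile1. Qed.

Local Lemma measurable_f q :
  measurable_fun setT (fun z : d.-tuple R * d.-tuple R => f q z.1 z.2).
Proof.
apply: measurable_funX; apply: (measurableT_comp mC); exact: measurable_tsub.
Qed.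

Local Lemma measurable_f_section q x : measurable_fun setT (f q x).
Proof.
apply: (@measurableT_comp _ _ _ _ _ _ (fun z : d.-tuple R * d.-tuple R => f q z.1 z.2) _ (pair x)).
  exact: measurable_f.
exact: measurable_pair1.
Qed.

Let G q x : \bar R := (\int[mu]_(y in E) (f q x y)%:E)%E.

Local Lemma integrable_f q x : mu.-integrable E (EFin \o f q x).
Proof.
apply: (bounded_integrable mE bounded_measure_lty (B := 1)) => [|y _].
  by apply: measurable_funTS; exact: measurable_f_section.
exact: f_bound.
Qed.

Local Lemma G_fin_num q x : G q x \is a fin_num.
Proof. exact: (integrable_fin_num mE (integrable_f q x)). Qed.

Local Lemma measurable_G q : measurable_fun setT (G q).
Proof.
(* [C^q] may change sign. Adding 1 makes the integrand nonnegative, as Tonelli requires, and the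
   finite [mu E] is subtracted afterwards. *)
pose H (z : d.-tuple R * d.-tuple R) : \bar R := ((f q z.1 z.2 + 1) * \1_E z.2)%:E.
have mH : measurable_fun setT H.
  apply/measurable_EFinP; apply: measurable_funM.
    by apply: measurable_funD => //; exact: measurable_f.
  exact: (measurableT_comp (measurable_indic mE) measurable_snd).
have H0 z : (0 <= H z)%E.
  rewrite lee_fin mulr_ge0 //; have := f_bound q z.1 z.2.
  by rewrite ler_norml => /andP[h _]; rewrite -lerBlDr sub0r.
have mF := measurable_fun_integral_sigma_finite (lebesgue_Rd_sigma_finite mu_lebesgue) mH H0.
rewrite (_ : G q = (fun x => (\int[mu]_y H (x, y) - mu E)%E)).
  exact: emeasurable_funB.
apply/funext => x.
have -> : (\int[mu]_y H (x, y) = G q x + mu E)%E.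
  rewrite -[mu E]mul1e -integral_cst // -integralD //; first last.
  - apply: (bounded_integrable mE bounded_measure_lty (f := cst 1) (B := 1)) => // y _.
    by rewrite /= normr1.
  - exact: integrable_f.
  rewrite [RHS]integral_mkcond; apply: eq_integral => y _.
  rewrite patchE /H /= indicE; case: ifPn => yE.
    by rewrite mulr1 EFinD.
  by rewrite mulr0.
by rewrite addeK // ge0_fin_numE // bounded_measure_lty.
Qed.

Local Lemma G_bound q x : (`|G q x| <= mu E)%E.
Proof.
apply: (le_trans (le_abse_integral _ _ _)) => //.
  by apply/measurable_EFinP; apply: measurable_funTS; exact: measurable_f_section.
rewrite -[leRHS]mul1e -integral_cst //; apply: ge0_le_integral => //.
  apply/measurable_EFinP; apply: measurable_funTS; apply: measurableT_comp => //.
  exact: measurable_f_section.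
by move=> y _; rewrite lee_fin; exact: f_bound.
Qed.

Local Lemma integrable_G q : mu.-integrable E (G q).
Proof.
have -> : G q = EFin \o (fine \o G q).
  by apply/funext => x /=; rewrite fineK // G_fin_num.
apply: (bounded_integrable mE bounded_measure_lty (B := fine (mu E))) => [|x _].
  apply: measurable_funTS; apply: measurableT_comp => //; exact: measurable_G.
by have := G_bound q x; rewrite -(fineK (G_fin_num q x)) -muE_fineK lee_fin.
Qed.

Definition cov_integral q : R := fine (\int[mu]_(x in E) G q x)%E.

Lemma cov_integralE q :
  (\int[mu]_(x in E) \int[mu]_(y in E) (C (tsub x y) ^+ q)%:E =
  (cov_integral q)%:E)%E.
Proof. by rewrite fineK //; exact: (integrable_fin_num mE (integrable_G q)). Qed.

Local Lemma dyadic_shell (z : d.-tuple R) (r : R) n :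
  (forall i, `|tnth z i| <= 2 ^+ n * r) ->
  exists k, [/\ (k <= n)%N, forall i, `|tnth z i| <= 2 ^+ k * r &
    k = 0%N \/ (0 < k)%N /\ exists i, 2 ^+ k.-1 * r < `|tnth z i|].
Proof.
elim: n => [|n IH] zn; first by exists 0%N; split => //; left.
have [|] := boolP [forall i, `|tnth z i| <= 2 ^+ n * r].
  by move=> /forallP /IH [k [kn h1 h2]]; exists k; split => //; exact: leqW.
rewrite negb_forall => /existsP[i]; rewrite -ltNge => zi.
by exists n.+1; split => //; right; split => //; exists i.
Qed.

Local Lemma sum_half_pow n : \sum_(k < n) (2 ^+ k)^-1 <= 2 :> R.
Proof.
suff -> : \sum_(k < n) (2 ^+ k)^-1 = 2 - 2 / 2 ^+ n :> R.
  by rewrite lerBlDr lerDl divr_ge0 // exprn_ge0.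
elim: n => [|n IH]; first by rewrite big_ord0 expr0 divr1 subrr.
by rewrite big_ord_recr /= IH exprS; field; rewrite expf_neq0.
Qed.

(* Dyadic shells around x: on the shell of radius 2^k r the power |C|^q is at
   most B / 2^(k(d+1)), and the shell has measure at most (2^(k+1) r)^d. *)
Local Lemma section_integral_upper (A r : R) q x : 0 < A -> 0 < r -> E x ->
  (forall z s, enorm z <= d%:R * (2 * M) -> 0 < s -> s * r <= enorm z ->
    `|C z| ^+ q <= A / s ^+ d.+1) ->
  (`|G q x| <= (2 ^+ d.+1 * (1 + A * 2 ^+ d.+1) * r ^+ d)%:E)%E.
Proof.
(* The 1 in [B] serves the core [k = 0], where only [|C|^q <= 1] is known. The factor [2 ^+ d.+1]
   arises because the inner radius of shell [k] is [2^(k-1) r], not [2^k r]. *)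
move=> A0 r0 Ex HA; set B := 1 + A * 2 ^+ d.+1.
have B0 : 0 <= B by rewrite addr_ge0 // mulr_ge0 ?exprn_ge0 // ltW.
have [n Hn] : exists n, 2 * M <= 2 ^+ n * r.
  exists (Num.trunc (2 * M / r)).+1.
  rewrite -ler_pdivrMr //; apply/ltW/(lt_trans (truncnS_gt _)).
  by rewrite -natrX ltr_nat ltn_expl.
pose w (k : 'I_n.+1) : R := B / (2 ^+ k) ^+ d.+1.
have w0 k : 0 <= w k by rewrite divr_ge0 // !exprn_ge0.
pose Q (k : 'I_n.+1) := tball x (2 ^+ k * r).
have mQ k : measurable (Q k) by exact: measurable_tball.
apply: (le_trans (le_abse_integral _ _ _)) => //.
  by apply/measurable_EFinP; apply: measurable_funTS; exact: measurable_f_section.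
apply: (@le_trans _ _ (\int[mu]_(y in E) (\sum_k w k * \1_(Q k) y)%:E)%E).
  apply: ge0_le_integral => //.
  - apply/measurable_EFinP; apply: measurable_funTS; apply: measurableT_comp => //.
    exact: measurable_f_section.
  - apply/measurable_EFinP; apply: measurable_funTS; apply: measurable_sum => k.
    by apply: measurable_funM => //; exact: measurable_indic.
  move=> y Ey; rewrite lee_fin.
  have zM i : `|tnth (tsub x y) i| <= 2 * M.
    rewrite tnth_mktuple; apply: (le_trans (ler_normB _ _)).
    by have := EM Ex i; have := EM Ey i; lra.
  have [k [kn h1 h2]] := @dyadic_shell (tsub x y) r n (fun i => le_trans (zM i) Hn).
  have kn' : (k < n.+1)%N by [].
  rewrite (bigD1 (Ordinal kn')) //=.
  have -> : (\1_(Q (Ordinal kn')) y : R) = 1.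
    rewrite indicE mem_set // => i; have := h1 i; rewrite tnth_mktuple /=.
    by rewrite ler_norml => /andP[? ?]; apply/andP; split; lra.
  apply: (@le_trans _ _ (w (Ordinal kn') * 1)); last first.
    by rewrite lerDl sumr_ge0 // => j _; rewrite mulr_ge0.
  rewrite mulr1 /w /=; case: h2 => [->|[k0 [i hi]]].
    rewrite expr0 expr1n divr1; apply: (le_trans (f_bound _ _ _)).
    by rewrite lerDl mulr_ge0 ?exprn_ge0 // ltW.
  rewrite normrX; apply: (le_trans (HA _ (2 ^+ k.-1) _ _ _)).
  - exact: enorm_le.
  - exact: exprn_gt0.
  - by apply: (le_trans (ltW hi)); exact: enorm_coord.
  rewrite -{2}(prednK k0) [2 ^+ k.-1.+1]exprS exprMn ler_pdivrMr ?exprn_gt0 //.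
  rewrite [leRHS](_ : _ = B / 2 ^+ d.+1); last first.
    by field; rewrite !expf_neq0 // expf_neq0.
  by rewrite ler_pdivlMr ?exprn_gt0 // lerDr.
rewrite integral_fin_sum_indic ?bounded_measure_lty // lee_fin.
(* The decay exponent [d.+1] exceeds the volume exponent [d] by one, which leaves a summable
   [2^(-k)]. *)
apply: (@le_trans _ _ (\sum_(k < n.+1) B * (2 * r) ^+ d * (2 ^+ k)^-1)).
  apply: ler_sum => k _.
  apply: (@le_trans _ _ (w k * (2 * (2 ^+ k * r)) ^+ d)).
    rewrite ler_wpM2l // -lee_fin fineK; last first.
      rewrite ge0_fin_numE //; apply: le_lt_trans bounded_measure_lty.
      by apply: le_measure; rewrite ?inE //; exact: measurableI.
    rewrite -(measure_tball mu_lebesgue x); last by rewrite mulr_ge0 ?exprn_ge0 // ltW.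
    apply: le_measure; rewrite ?inE //; last exact: measurable_tball.
    exact: measurableI.
  rewrite /w le_eqVlt; apply/orP; left; apply/eqP.
  rewrite !exprMn exprS; field.
  by rewrite ?expf_neq0 // expf_neq0.
rewrite -mulr_sumr.
rewrite [leRHS](_ : _ = B * (2 * r) ^+ d * 2); last by rewrite exprMn exprS; ring.
by rewrite ler_wpM2l ?sum_half_pow // mulr_ge0 // exprn_ge0 // mulr_ge0 // ltW.
Qed.

Lemma cov_integral_upper (A r : R) q : 0 < A -> 0 < r ->
  (forall z s, enorm z <= d%:R * (2 * M) -> 0 < s -> s * r <= enorm z ->
    `|C z| ^+ q <= A / s ^+ d.+1) ->
  `|cov_integral q| <= 2 ^+ d.+1 * (1 + A * 2 ^+ d.+1) * fine (mu E) * r ^+ d.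
Proof.
move=> A0 r0 HA; rewrite -lee_fin.
have -> : (`|cov_integral q|%:E = `| \int[mu]_(x in E) G q x|)%E.
  by rewrite -abse_EFin -cov_integralE.
have mG : measurable_fun E (G q) by apply: measurable_funTS; exact: measurable_G.
apply: (le_trans (le_abse_integral _ _ _)) => //.
rewrite mulrAC EFinM muE_fineK -integral_cst //.
apply: ge0_le_integral => //.
  exact: measurableT_comp.
by move=> x Ex; exact: section_integral_upper.
Qed.


Local Lemma integrable_cst_E (b : R) : mu.-integrable E (EFin \o cst b).
Proof.
by apply: (bounded_integrable mE bounded_measure_lty (B := `|b|)).
Qed.

Section step_functions.
Variables (I : finType) (Q : I -> set (d.-tuple R)) (a : I -> R) (b : R).
Hypothesis mQ : forall i, measurable (Q i).
Hypothesis a0 : forall i, 0 <= a i.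

Local Lemma integrable_sum_indic :
  mu.-integrable E (EFin \o (fun x => \sum_i a i * \1_(Q i) x)).
Proof.
apply: (bounded_integrable mE bounded_measure_lty (B := \sum_i a i)).
  apply: measurable_funTS; apply: measurable_sum => i.
  by apply: measurable_funM => //; exact: measurable_indic.
move=> x _; rewrite ger0_norm; last by apply: sumr_ge0 => i _; rewrite mulr_ge0.
apply: ler_sum => i _; rewrite -[leRHS]mulr1 ler_wpM2l // indicE.
Qed.

Local Lemma integral_step :
  (\int[mu]_(x in E) (\sum_i a i * \1_(Q i) x - b)%:E =
   (\sum_i a i * fine (mu (Q i `&` E)) - b * fine (mu E))%:E)%E.
Proof.
under eq_integral do rewrite EFinB.
rewrite integralB_EFin //; first last.
- exact: integrable_cst_E.
- exact: integrable_sum_indic.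
rewrite integral_fin_sum_indic ?bounded_measure_lty // [X in (_ - X)%E](integral_cst mu mE b%:E).
by rewrite EFinB EFinM muE_fineK.
Qed.

Local Lemma integrable_step :
  mu.-integrable E (fun x => (\sum_i a i * \1_(Q i) x - b)%:E).
Proof.
rewrite (_ : (fun x => _) = ((EFin \o (fun x => (\sum_i a i * \1_(Q i) x)%R)) \- (EFin \o cst b))%E).
  by apply: integrableB => //; [exact: integrable_sum_indic|exact: integrable_cst_E].
by apply/funext => x /=; rewrite EFinB.
Qed.

End step_functions.

(* C(x - y)^q is at least 1/2 for x, y in a common cell of a grid of mesh s, and
   at least -b elsewhere; Cauchy-Schwarz over the cells concludes. *)
Lemma cov_integral_lower (s b : R) q : (0 < d)%N -> 0 < s -> 0 <= b ->
  (forall z, - b <= C z ^+ q) ->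
  (forall z, enorm z <= d%:R * s -> 2^-1 <= C z ^+ q) ->
  fine (mu E) ^+ 2 / 2 * (s / (2 * M + s)) ^+ d - b * fine (mu E) ^+ 2 <=
    cov_integral q.
Proof.
move=> d0 s0 b0 Cb Cs; set m := fine (mu E).
(* [n] is the number of cells per side: the first inequality makes the grid cover [E], the second
   bounds the number of cells by [((2M + s)/s)^d]. *)
have [n [n1 n2]] : exists n : nat, 2 * M / s < n%:R /\ n%:R <= (2 * M + s) / s.
  exists (Num.trunc (2 * M / s)).+1; split; first exact: truncnS_gt.
  have -> : (2 * M + s) / s = 2 * M / s + 1 by field; rewrite gt_eqF.
  rewrite -[X in X <= _]natr1 lerD2r.
  by rewrite truncn_le // divr_ge0 ?mulr_ge0 // ltW.
pose J := {ffun 'I_d -> 'I_n}.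
pose Q (j : J) : set (d.-tuple R) :=
  [set x | forall i, s * (j i)%:R <= tnth x i + M < s * (j i).+1%:R].
have mQ j : measurable (Q j).
  apply: (@measurable_tuple_box _ _
    (fun i => [set c | s * (j i)%:R <= c + M < s * (j i).+1%:R])) => i.
  rewrite (_ : [set c | _] = `[s * (j i)%:R - M, s * (j i).+1%:R - M[%classic) //.
  by rewrite set_itvco; apply/seteqP; split => c /=; rewrite lerBlDr ltrBrDr.
have coverQ x : E x -> exists j, Q j x.
  move=> Ex; have H i : exists j : 'I_n, s * j%:R <= tnth x i + M < s * j.+1%:R.
    have := EM Ex i; rewrite ler_norml => /andP[x1 x2].
    have t0 : 0 <= (tnth x i + M) / s by rewrite divr_ge0 ?(ltW s0) //; lra.
    have /andP[t1 t2] := truncn_itv t0.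
    have tn : (Num.trunc ((tnth x i + M) / s) < n)%N.
      rewrite -(ltr_nat R); apply: le_lt_trans n1; apply: (le_trans t1).
      by rewrite ler_pM2r ?invr_gt0 //; lra.
    exists (Ordinal tn) => /=; apply/andP; split.
      by rewrite mulrC -ler_pdivlMr.
    by rewrite mulrC -ltr_pdivrMr.
  by have [j Hj] := fin_all_exists H; exists (finfun j) => i; rewrite ffunE.
have injQ j j' x : Q j x -> Q j' x -> j' = j.
  move=> Hj Hj'; apply/ffunP => i; apply/val_inj/eqP.
  have /andP[h1 h2] := Hj i; have /andP[h3 h4] := Hj' i.
  have := le_lt_trans h1 h4; have := le_lt_trans h3 h2.
  by rewrite !ltr_pM2l // !ltr_nat !ltnS eqn_leq => -> ->.
have sumQ (a : J -> R) j x : Q j x -> \sum_j' a j' * \1_(Q j') x = a j.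
  move=> Qx; rewrite (bigD1 j) //= indicE mem_set // mulr1 big1 ?addr0 // => j' jj'.
  rewrite indicE memNset ?mulr0 // => Q'x.
  by rewrite (injQ _ _ _ Qx Q'x) eqxx in jj'.
pose mj j := fine (mu (Q j `&` E)).
have mj0 j : 0 <= mj j by rewrite fine_ge0.
have sum_mj : \sum_j mj j = m.
  have := integral_fin_sum_indic mE bounded_measure_lty mQ (fun=> ler01 : 0 <= (1 : R)).
  rewrite (eq_integral (cst 1%E)); last first.
    move=> x; rewrite inE => /coverQ [j Qx].
    by rewrite (sumQ (fun=> 1) _ _ Qx).
  rewrite integral_cst // mul1e -muE_fineK -/m => -[->].
  by apply: eq_bigr => j _; rewrite mul1r.
(* For [x] in cell [j] the section is at least [1/2] on that cell and at least [-b] elsewhere, so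
   the step function [2^-1 * \1_(Q j) - b] minorizes it on all of [E]. *)
have sec j x : E x -> Q j x -> ((2^-1 * mj j - b * m)%:E <= G q x)%E.
  move=> Ex Qx.
  have mQj (i : 'I_1) : measurable (Q j) by exact: mQ.
  have half0 (i : 'I_1) : 0 <= 2^-1 :> R by rewrite invr_ge0.
  have := integral_step b mQj half0.
  rewrite big_ord1 => <-; apply: le_integral => //.
  - exact: integrable_step mQj half0.
  - exact: integrable_f.
  clear mQj half0.
  move=> y; rewrite inE => Ey; rewrite big_ord1 lee_fin indicE.
  have [yQ|yQ] := boolP (y \in Q j); last first.
    by rewrite mulr0 sub0r; exact: Cb.
  rewrite inE in yQ; rewrite mulr1.
  have h : 2^-1 <= f q x y.
    apply: Cs; apply: enorm_le => i; rewrite tnth_mktuple.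
    have /andP[x1 x2] := Qx i; have /andP[y1 y2] := yQ i.
    move: x2 y2; rewrite -[(j i).+1%:R]natr1 mulrDr mulr1 => x2 y2.
    by rewrite ler_norml; apply/andP; split; lra.
  by lra.
have N0 : 0 < ((2 * M + s) / s) ^+ d.
  by rewrite exprn_gt0 // divr_gt0 // addr_gt0 // mulr_gt0.
have cardJ : #|J|%:R <= ((2 * M + s) / s) ^+ d.
  by rewrite card_ffun !card_ord natrX lerXn2r ?nnegrE // divr_ge0 ?addr_ge0 ?mulr_ge0 // ltW.
have CS := sum_sqr_ge mj N0 cardJ; rewrite sum_mj in CS.
rewrite -lee_fin -cov_integralE.
apply: (@le_trans _ _ (\int[mu]_(x in E) (\sum_j 2^-1 * mj j * \1_(Q j) x - b * m)%:E)%E); last first.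
  apply: le_integral => //; first by apply: integrable_step => // j; rewrite mulr_ge0.
    exact: integrable_G.
  move=> x; rewrite inE => Ex; have [j Qx] := coverQ _ Ex.
  by rewrite (sumQ _ _ _ Qx); exact: sec.
rewrite integral_step // => [|j]; last by rewrite mulr_ge0.
rewrite lee_fin -/m.
have -> : \sum_j 2^-1 * mj j * fine (mu (Q j `&` E)) = 2^-1 * \sum_j mj j ^+ 2.
  by rewrite mulr_sumr; apply: eq_bigr => j _; rewrite /mj; ring.
move: CS; rewrite -exprVn invf_div; nra.
Qed.

End covariance_power_integral.

(** * Series *)

Section real_series.
Variable R : realType.
Implicit Types t : R^nat.

Lemma series_addn t N n : series (fun k => t (k + N)%N) n = series t (n + N)%N - series t N.
Proof.
rewrite /series /=; elim: n => [|n IH]; first by rewrite big_geq // add0n subrr.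
by rewrite addSn !big_nat_recr //= IH addrAC.
Qed.

Lemma cvg_series_addn t N : cvgn (series (fun k => t (k + N)%N)) <-> cvgn (series t).
Proof.
split => [h|h]; apply/cvg_ex; case/cvg_ex: h => l hl.
  exists (l + series t N); rewrite -(cvg_shiftn N).
  rewrite (_ : [sequence _]_n = (fun n => series (fun k => t (k + N)%N) n + series t N)).
    by apply: cvgD => //; exact: cvg_cst.
  by apply/funext => n /=; rewrite series_addn subrK.
exists (l - series t N).
rewrite (_ : series (fun k => t (k + N)%N) = (fun n => series t (n + N)%N - series t N)).
  by apply: cvgB; [rewrite -(cvg_shiftn N) in hl|exact: cvg_cst].
by apply/funext => n; rewrite series_addn.
Qed.

(** Nonnegativity is asked only from [N] on, since integrals of odd powers of [C] may be negative
    for small [q]. Finitely many real terms do not affect finiteness. *)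
Lemma eseries_lty_cvg t N : (forall n, (N <= n)%N -> 0 <= t n) ->
  (\sum_(0 <= q <oo) (t q)%:E < +oo)%E <-> cvgn (series t).
Proof.
move=> t0.
have -> : (\sum_(0 <= q <oo) (t q)%:E)%E = limn (EFin \o series t).
  by congr (limn _); apply/funext => n /=; rewrite sumEFin.
split => [|ct]; last by rewrite EFin_lim // ltry.
apply: contraPP => nct; rewrite (_ : limn _ = +oo%E) ?ltxx //.
apply: cvg_lim => //; apply/cvgeryP; rewrite -(cvg_shiftn N).
apply: nondecreasing_dvgn_lt.
  apply/nondecreasing_seqP => n /=.
  by rewrite addSn /series /= big_nat_recr //= lerDl t0 // leq_addl.
move=> /cvg_ex[l]; rewrite (cvg_shiftn N (series t)) => hl.
by apply: nct; apply/cvg_ex; exists l.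
Qed.

(** A telescoping majorant: with [e = a - 1] and [y = x + 1], the bounds [ln y - ln x >= 1/y] and
    [exp z >= 1 + z] give [x^(-e) >= y^(-e) (1 + e/y)], that is
    [y^(-a) <= (x^(-e) - y^(-e)) / e]. *)
Lemma cvg_riemann_series (a : R) : 1 < a ->
  cvgn (series (fun n => n.+1%:R `^ (- a) : R)).
Proof.
move=> a1; apply/(cvg_series_addn _ 1).
pose e := a - 1; have e0 : 0 < e by rewrite /e; lra.
pose b (n : nat) : R := n.+1%:R `^ (- e).
have step n : (n + 1).+1%:R `^ (- a) <= e^-1 * (b n - b n.+1).
  rewrite addn1 /b; set x : R := n.+1%:R; set y : R := n.+2%:R.
  have x0 : 0 < x by rewrite ltr0n.
  have y0 : 0 < y by rewrite ltr0n.
  have yx : y = x + 1 by rewrite natr1.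
  clearbody x y.
  have -> : y `^ (- a) = y `^ (- e) / y.
    rewrite /e (_ : - a = - (a - 1) - 1); last by ring.
    by rewrite powRD ?(gt_eqF y0) ?implybT // powR_inv1 // ltW.
  have lnyx : y^-1 <= ln y - ln x.
    have h : ln (1 + - y^-1) <= - y^-1.
      apply: le_ln1Dx; rewrite ltrN2 invf_lt1 // yx; lra.
    have : 1 + - y^-1 = x / y.
      rewrite -[in RHS](_ : y - 1 = x); last by rewrite yx addrK.
      by rewrite mulrBl mul1r divff // gt_eqF.
    by move=> e1; rewrite -lerN2 opprB -ln_div ?posrE // -e1.
  have -> : x `^ (- e) = y `^ (- e) * expR (e * (ln y - ln x)).
    by rewrite /powR !gt_eqF // -expRD; congr expR; ring.
  have E1 := expR_ge1Dx (e * (ln y - ln x)).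
  have ye : 0 <= y `^ (- e) by exact: powR_ge0.
  rewrite -[X in e^-1 * (_ - X)]mulr1 -mulrBr mulrCA ler_wpM2l //.
  rewrite mulrC ler_pdivlMr //.
  have : y^-1 * e <= (ln y - ln x) * e by rewrite ler_wpM2r // ltW.
  lra.
apply: nondecreasing_is_cvgn.
  apply/nondecreasing_seqP => n.
  by rewrite /series /= big_nat_recr //= lerDl powR_ge0.
exists (e^-1 * b 0%N) => _ [n _ <-].
apply: (@le_trans _ _ (e^-1 * (b 0%N - b n))).
  rewrite /series /=; elim: n => [|n IH]; first by rewrite big_geq // subrr mulr0.
  rewrite big_nat_recr //=; apply: (le_trans (lerD IH (step n))).
  by rewrite -mulrDr addrA subrK.
by rewrite ler_wpM2l ?invr_ge0 ?(ltW e0) // gerBl powR_ge0.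
Qed.

Lemma series_domination (t v : R^nat) N K :
  (forall n, (N <= n)%N -> `|t n| <= K * v n) -> (forall n, 0 <= v n) ->
  cvgn (series v) -> cvgn (series t).
Proof.
move=> tv v0 cv; apply/(cvg_series_addn _ N).
apply: normed_cvg; apply: (@series_le_cvg _ _ (fun n => `|K| * v (n + N)%N)).
- by move=> n; exact: normr_ge0.
- by move=> n; rewrite mulr_ge0.
- move=> n; apply: (le_trans (tv _ (leq_addl _ _))).
  by rewrite ler_wpM2r // ler_norm.
rewrite (_ : series _ = `|K| *: series (fun n => v (n + N)%N)).
  by apply: is_cvgZr; apply/cvg_series_addn.
by apply/funext => n; rewrite /series /= -mulr_sumr.
Qed.

(** * Convergence criterion for the general term *)

Section growth.
Variables (t h J : R^nat) (p N : nat) (s F c K c' K' : R).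
Hypothesis F0 : 0 < F.
Hypothesis c0 : 0 < c.
Hypothesis K0 : 0 < K.
Hypothesis c'0 : 0 < c'.
Hypothesis tE : forall n, t n.+1 = n.+1%:R ^+ p * (h n * F / n.+1%:R) * J n.+1.
Hypothesis h0 : forall n, 0 <= h n.
Hypothesis hK : forall n, (N <= n)%N -> h n <= K / Num.sqrt n%:R.
Hypothesis hc : forall n, (N <= n)%N -> c / Num.sqrt n%:R <= h n + h n.+1.
Hypothesis JK : forall n, (0 < n)%N -> `|J n| <= K' * n%:R `^ (- s).
Hypothesis Jc : forall n, (N <= n)%N -> c' * n%:R `^ (- s) <= J n.

Lemma growth_ge0 n : (N < n)%N -> 0 <= t n.
Proof.
case: n => // n Nn; rewrite tE mulr_ge0 ?mulr_ge0 ?exprn_ge0 ?invr_ge0 ?h0 ?(ltW F0) //.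
by apply: le_trans (Jc (ltnW Nn)); rewrite mulr_ge0 ?powR_ge0 // ltW.
Qed.

Local Lemma powR_exponent n :
  n.+1%:R ^+ p / n.+1%:R * n.+1%:R `^ (- s) = n.+1%:R `^ (p%:R - 1 - s) :> R.
Proof.
by rewrite !powRD ?pnatr_eq0 ?implybT // powR_mulrn // powR_inv1.
Qed.

Lemma growth_cvg : p%:R < s + 2^-1 -> cvgn (series t).
Proof.
move=> ps; have a1 : 1 < 3 / 2 + s - p%:R by lra.
apply/(cvg_series_addn _ 1).
apply: (series_domination (N := N.+1) (K := 2 * K * F * K')) (cvg_riemann_series a1);
  last by move=> n; exact: powR_ge0.
move=> n Nn; rewrite addn1 tE; set y : R := n.+1%:R.
have y0 : 0 < y by rewrite ltr0n.
have n0 : 0 < n%:R :> R by rewrite ltr0n (leq_trans _ Nn).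
(* The index of [h] lags one behind that of [t]; the factor 2 pays for passing from [sqrt n] to
   [sqrt (n+1)], as [n + 1 <= 4 n]. *)
have hn : h n <= 2 * K * y `^ (- 2^-1).
  apply: (le_trans (hK (ltnW Nn))).
  rewrite powRN powR12_sqrt ?(ltW y0) // -mulrA mulrCA ler_wpM2l ?(ltW K0) //.
  rewrite -[leLHS]mul1r ler_pdivrMr ?sqrtr_gt0 //.
  rewrite mulrAC ler_pdivlMr ?sqrtr_gt0 // mul1r.
  have -> : 2 = Num.sqrt (2 ^+ 2) :> R by rewrite sqrtr_sqr ger0_norm.
  rewrite -sqrtrM ?sqr_ge0 // ler_sqrt ?mulr_ge0 ?sqr_ge0 ?(ltW n0) //.
  have : 1 <= n%:R :> R by rewrite ler1n (leq_trans _ Nn).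
  rewrite /y -natr1; lra.
have -> : - (3 / 2 + s - p%:R) = p%:R - 1 - s - 2^-1 by field.
rewrite [in leRHS]powRD ?(gt_eqF y0) ?implybT // -powR_exponent -/y.
rewrite normrM ger0_norm; last by rewrite !mulr_ge0 ?exprn_ge0 ?invr_ge0 ?h0 ?(ltW F0) ?(ltW y0).
apply: (@le_trans _ _ (y ^+ p * (2 * K * y `^ (- 2^-1) * F / y) * (K' * y `^ (- s)))).
  apply: ler_pM => //; last exact: JK.
    by rewrite !mulr_ge0 ?exprn_ge0 ?invr_ge0 ?h0 ?(ltW F0) ?(ltW y0).
  by rewrite ler_wpM2l ?exprn_ge0 ?(ltW y0) // ler_wpM2r ?invr_ge0 ?(ltW y0) // ler_wpM2r // ltW.
by rewrite le_eqVlt; apply/orP; left; apply/eqP; ring.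
Qed.

(** Here [p - 1 - s >= -1/2], so [t n.+1] is at least a constant times [h n / sqrt (n+1)]. As [h n]
    alone may vanish, two consecutive terms are added; [hc] bounds the pair below by a multiple of
    [1 / (n+2)], and the harmonic series also settles the case of equality. *)
Lemma growth_dvg : s + 2^-1 <= p%:R -> ~ cvgn (series t).
Proof.
move=> ps ct.
have low n : (N <= n)%N -> c' * F * h n / Num.sqrt n.+1%:R <= t n.+1.
  move=> Nn; rewrite tE; set y : R := n.+1%:R.
  have y0 : 0 < y by rewrite ltr0n.
  have y1 : 1 <= y by rewrite ler1n.
  apply: (@le_trans _ _ (y ^+ p * (h n * F / y) * (c' * y `^ (- s)))); last first.
    rewrite ler_wpM2l ?Jc ?(leqW Nn) //.
    by rewrite !mulr_ge0 ?exprn_ge0 ?invr_ge0 ?h0 ?(ltW F0) ?(ltW y0).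
  rewrite [leRHS](_ : _ = c' * F * h n * (y ^+ p / y * y `^ (- s))); last by ring.
  rewrite powR_exponent ler_wpM2l //.
    by rewrite !mulr_ge0 ?h0 ?(ltW F0) ?(ltW c'0).
  rewrite -powR12_sqrt ?(ltW y0) // -powRN; apply: ler_powR => //; lra.
pose c2 := c' * F * c; have c20 : 0 < c2 by rewrite !mulr_gt0.
have pair n : (N < n)%N -> c2 / n.+2%:R <= t n.+1 + t n.+2.
  move=> Nn; have n0 : 0 < n%:R :> R by rewrite ltr0n (leq_trans _ Nn).
  have sn0 : 0 < Num.sqrt n%:R :> R by rewrite sqrtr_gt0.
  have s2 : 0 < Num.sqrt n.+2%:R :> R by rewrite sqrtr_gt0 ltr0n.
  have h1 := low _ (ltnW Nn); have h2 := low _ (leqW (ltnW Nn)).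
  apply: le_trans (lerD h1 h2).
  apply: (@le_trans _ _ (c' * F * (h n + h n.+1) / Num.sqrt n.+2%:R)); last first.
    rewrite mulrDr mulrDl lerD2r ler_wpM2l ?mulr_ge0 ?(ltW c'0) ?(ltW F0) //.
    by rewrite lef_pV2 ?posrE ?sqrtr_gt0 ?ltr0n // ler_sqrt // ler_nat.
  apply: (@le_trans _ _ (c' * F * (c / Num.sqrt n%:R) / Num.sqrt n.+2%:R)); last first.
    rewrite ler_wpM2r ?invr_ge0 ?(ltW s2) // ler_wpM2l ?mulr_ge0 ?(ltW c'0) ?(ltW F0) //.
    exact/hc/ltnW.
  have -> : c' * F * (c / Num.sqrt n%:R) / Num.sqrt n.+2%:R =
     c2 / (Num.sqrt n%:R * Num.sqrt n.+2%:R).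
    by rewrite /c2; field; rewrite !gt_eqF.
  rewrite ler_wpM2l ?(ltW c20) // lef_pV2 ?posrE ?mulr_gt0 ?ltr0n //.
  rewrite -[leRHS]sqr_sqrtr // expr2 ler_wpM2r ?(ltW s2) // ler_sqrt //.
  by rewrite ler_nat leqW.
have cpair : cvgn (series (fun n => t n.+1 + t n.+2)).
  rewrite (_ : series _ = series (fun n => t (n + 1)%N) \+ series (fun n => t (n + 2)%N)).
    by apply: is_cvgD; apply/cvg_series_addn.
  apply/funext => n; rewrite /series /= -big_split /=.
  by apply: eq_bigr => i _; rewrite addn1 addn2.
apply: (@dvg_harmonic R); apply/(cvg_series_addn _ 1).
have tpair0 n : 0 <= t (n + N.+1).+1 + t (n + N.+1).+2.
  have Nn : (N < (n + N.+1).+1)%N by rewrite addnS ltnS ltnW // ltnS leq_addl.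
  by rewrite addr_ge0 // growth_ge0 // ltnW.
apply/(cvg_series_addn _ N.+1).
apply: (@series_domination _ (fun n => t (n + N.+1).+1 + t (n + N.+1).+2) 0 c2^-1) => //.
- move=> n _; rewrite ger0_norm ?invr_ge0 // addn1.
  rewrite mulrC ler_pdivlMr // mulrC; apply: pair.
  by rewrite addnS ltnS leq_addl.
- exact/(cvg_series_addn (fun n => t n.+1 + t n.+2) N.+1).
Qed.

End growth.
End real_series.

(** This makes the negative contribution of the far region negligible against the core. One extra
    power of [1/q] is extracted so that the constant [e] can be arbitrarily small. *)
Lemma expr_le_powRN (R : realType) (rho s e : R) : 0 <= rho < 1 -> 0 < e ->
  exists N : nat, forall q, (N < q)%N -> rho ^+ q <= e * q%:R `^ (- s).
Proof.
move=> /andP[r0 r1] e0; have c0 : 0 < 1 - rho by lra.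
have [n sn] : exists n : nat, s + 1 <= n%:R.
  by exists (Num.trunc (s + 1)).+1; exact/ltW/truncnS_gt.
have [A A0 HA] := expRN_powR_bound n c0 ltr01.
exists (Num.trunc (A / e)) => q qN.
have q0 : 0 < q%:R :> R by rewrite ltr0n (leq_ltn_trans _ qN).
have q1 : 1 <= q%:R :> R by rewrite ler1n (leq_ltn_trans _ qN).
have Aq : A / q%:R <= e.
  rewrite ler_pdivrMr // mulrC -ler_pdivrMr //; apply/ltW.
  by apply: (lt_le_trans (truncnS_gt _)); rewrite ler_nat.
have rq : rho ^+ q <= expR (- ((1 - rho) * q%:R)).
  rewrite mulrC -mulrN expRM_natl lerXn2r ?nnegrE ?expR_ge0 //.
  by apply: le_trans (expR_ge1Dx _); lra.
apply: (le_trans rq).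
have := HA _ q0; rewrite powRr1 ?(ltW q0) // mulrC -ler_pdivlMr ?exprn_gt0 // => h.
apply: (le_trans h).
apply: (@le_trans _ _ (A * q%:R `^ (- (s + 1)))).
  rewrite ler_wpM2l ?(ltW A0) // -powR_mulrn ?(ltW q0) // -powRN.
  by apply: ler_powR => //; rewrite lerN2.
rewrite opprD powRD ?(gt_eqF q0) ?implybT // powR_inv1 ?(ltW q0) //.
by rewrite [leLHS](_ : _ = A / q%:R * q%:R `^ (- s)) ?ler_wpM2r ?powR_ge0 //; ring.
Qed.

Lemma cov_integral_asymp (R : realType) (d : nat) (d0 : (0 < d)%N)
  (C : d.-tuple R -> R) (alpha C1 C2 C3 delta eps M : R)
  (mu : {measure set (d.-tuple R) -> \bar R}) (E : set (d.-tuple R)) :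
  0 < alpha -> measurable_fun setT C -> pos_def_fun C -> C (tzero R d) = 1 ->
  0 < C1 -> 0 < C2 -> 0 < C3 -> 0 < delta -> 0 < eps ->
  (forall x : d.-tuple R, x != tzero R d -> `|C x| <= C1 * enorm x `^ (- delta)) ->
  (forall x : d.-tuple R, enorm x <= eps ->
    C2 * enorm x `^ alpha <= 1 - C x <= C3 * enorm x `^ alpha) ->
  is_lebesgue_Rd mu -> measurable E -> (0 < mu E)%E -> 0 < M ->
  (forall x, E x -> forall i, `|tnth x i| <= M) ->
  exists (c K : R) (N : nat), 0 < c /\
    (forall q, (0 < q)%N -> `|cov_integral C mu E q| <= K * q%:R `^ (- (d%:R / alpha))) /\
    (forall q, (N <= q)%N -> c * q%:R `^ (- (d%:R / alpha)) <= cov_integral C mu E q).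
Proof.
move=> a0 mC Cpd C0 C10 C20 C30 delta0 eps0 Cdecay Cnear mu_leb mE mE0 M0 EM.
have Cle1 := cov_norm_le1 Cpd C0.
have dR0 : 0 < d%:R :> R by rewrite ltr0n.
have D0 : 0 < d%:R * (2 * M) by rewrite !mulr_gt0.
have [A A0 HA] := cov_pow_upper Cpd C0 a0 C10 C20 C30 delta0 eps0 Cdecay Cnear d.+1 D0.
have [k [rho [N1 [k0 [rho01 Hlow]]]]] :=
  cov_pow_lower Cpd C0 a0 C10 C30 delta0 eps0 Cdecay Cnear.
set r := fun q : nat => q%:R `^ (- alpha^-1) : R.
have rE q : r q ^+ d = q%:R `^ (- (d%:R / alpha)).
  by rewrite /r -powR_mulrn ?powR_ge0 // -powRrM mulNr mulrC.
have r0 q : (0 < q)%N -> 0 < r q by move=> q0; rewrite powR_gt0 // ltr0n.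
have r1 q : (0 < q)%N -> r q <= 1.
  move=> q0; rewrite -(powRr0 q%:R); apply: ler_powR; first by rewrite ler1n.
  by rewrite oppr_le0 invr_ge0 ltW.
set m := fine (mu E).
have muEfin : mu E \is a fin_num by rewrite ge0_fin_numE // (bounded_measure_lty mu_leb mE M0 EM).
have m0 : 0 < m by rewrite fine_gt0 // mE0 /= -ge0_fin_numE.
(* [enorm_le] loses a factor [d], so a mesh of [(k/d) r q] keeps differences within a cell in the
   core. Since [r q <= 1], the denominator [2 M + w * r q] may be replaced by the constant
   [2 M + w]. *)
pose w := k / d%:R; have w0 : 0 < w by rewrite divr_gt0.
pose c3 := w / (2 * M + w); have c30 : 0 < c3 by rewrite divr_gt0 // addr_gt0 // mulr_gt0.
(* The main term of the lower bound carries [c3 ^+ d / 2]; half of it is given up to absorb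
   [rho ^+ q]. *)
have e0 : 0 < c3 ^+ d / 4 by rewrite divr_gt0 // exprn_gt0.
have [N2 HN2] := expr_le_powRN (d%:R / alpha) rho01 e0.
exists (m ^+ 2 * (c3 ^+ d / 4)), (2 ^+ d.+1 * (1 + A * 2 ^+ d.+1) * m), (maxn N1 N2).+1.
split; first by rewrite mulr_gt0 // exprn_gt0.
split=> q.
  move=> q0; rewrite -rE.
  apply: (cov_integral_upper mC Cle1 mu_leb mE M0 EM A0 (r0 _ q0)) => z s zD s0 sz.
  exact: HA.
rewrite gtn_max => /andP[qN1 qN2].
have q0 : (0 < q)%N by rewrite (leq_ltn_trans _ qN1).
have s0 : 0 < w * r q by rewrite mulr_gt0 // r0.
have rho0 : 0 <= rho ^+ q by rewrite exprn_ge0; case/andP: rho01.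
have ds : d%:R * (w * r q) = k * r q by rewrite /w; field; rewrite gt_eqF.
have := cov_integral_lower mC Cle1 mu_leb mE M0 EM d0 s0 rho0.
move=> /(_ q (fun z => (Hlow q z qN1).1)).
rewrite ds => /(_ (fun z => (Hlow q z qN1).2)); apply: le_trans.
have h := HN2 _ qN2; rewrite -rE in h.
have c3r : c3 * r q <= w * r q / (2 * M + w * r q).
  rewrite /c3 mulrAC ler_wpM2l ?(ltW s0) //.
  have M2 : 0 < 2 * M by rewrite mulr_gt0.
  rewrite lef_pV2 ?posrE ?addr_gt0 // lerD2l -[leRHS]mulr1 ler_wpM2l ?(ltW w0) //.
  exact: r1.
have c3rd : c3 ^+ d * r q ^+ d <= (w * r q / (2 * M + w * r q)) ^+ d.
  rewrite -exprMn lerXn2r ?nnegrE //.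
    by rewrite mulr_ge0 ?(ltW c30) // ltW // r0.
  by rewrite divr_ge0 ?addr_ge0 ?mulr_ge0 ?(ltW M0) ?(ltW s0) // ltW // r0.
rewrite -rE -/m.
have m2 : 0 <= m ^+ 2 by exact: sqr_ge0.
have u1 := ler_wpM2l m2 c3rd; have u2 := ler_wpM2l m2 h.
have -> : m ^+ 2 * (c3 ^+ d / 4) * r q ^+ d =
  m ^+ 2 * (c3 ^+ d * r q ^+ d) / 2 - m ^+ 2 * (c3 ^+ d / 4 * r q ^+ d) by field.
lra.
Qed.

Unset Implicit Arguments.
Set Strict Implicit.

Theorem mainTheorem4 (R : realType) (d : nat) (hd : (1 <= d)%N)
  (C : d.-tuple R -> R) (alpha : R) (halpha : 0 < alpha)
  (hCcont : continuous (fun v : 'rV[R]_d => C (rv2t v)))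
  (hCcov : pos_def_fun C)
  (hC0 : C (tzero R d) = 1)
  (hbounds : exists C1 C2 C3 delta eps : R,
     [/\ 0 < C1, 0 < C2, 0 < C3, 0 < delta & 0 < eps] /\
     (forall x : d.-tuple R, x != tzero R d ->
        `|C x| <= C1 * enorm x `^ (- delta)) /\
     (forall x : d.-tuple R, enorm x <= eps ->
        C2 * enorm x `^ alpha <= 1 - C x <= C3 * enorm x `^ alpha))
  (mu : {measure set (d.-tuple R) -> \bar R}) (hmu : is_lebesgue_Rd mu)
  (E : set (d.-tuple R)) (hEc : compact (@t2rv R d @` E))
  (hEpos : (0 < mu E)%E)
  (u : R) (p : nat) :
  in_Dp2 mu E (fun x y => C (tsub x y)) (fun z => if u <= z then 1 else 0) p
  <-> (p%:R < d%:R / alpha + 2^-1 :> R).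
Proof.
have mE : measurable E.
  by case: d hd C hCcont hCcov hC0 hbounds mu hmu E hEc hEpos => // n *;
    exact: measurable_compact_tuple.
have mC := measurable_continuous_tuple hCcont.
have Cle1 := cov_norm_le1 hCcov hC0.
have [M M0 EM] := compact_tuple_bounded hEc.
case: hbounds => C1 [C2 [C3 [delta [eps [[C10 C20 C30 delta0 eps0] [Cdecay Cnear]]]]]].
have [c' [K' [N1 [c'0 [JK Jc]]]]] := cov_integral_asymp hd halpha mC hCcov hC0
  C10 C20 C30 delta0 eps0 Cdecay Cnear hmu mE hEpos M0 EM.
have [c [K [N2 [c0 [K0 Hh]]]]] := hermite_asymp u.
set J := cov_integral C mu E in JK Jc.
pose a q := fine (hermite_coef (fun z : R => if u <= z then 1 else 0) q).
pose t q : R := q%:R ^+ p * q`!%:R * a q ^+ 2 * J q.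
pose h q : R := hermite q u ^+ 2 / q`!%:R.
have tE n : t n.+1 = n.+1%:R ^+ p * (h n * gauss_density u ^+ 2 / n.+1%:R) * J n.+1.
  rewrite /t /a hermite_coef_indicS /= /h factS natrM.
  have y0 : n.+1%:R != 0 :> R by rewrite pnatr_eq0.
  have f0 : n`!%:R != 0 :> R by rewrite pnatr_eq0 -lt0n fact_gt0.
  by move: (n.+1%:R : R) y0 (n`!%:R : R) f0 => y y0 f f0; field; rewrite y0 f0.
have h0 n : 0 <= h n by rewrite divr_ge0 // sqr_ge0.
have F0 : 0 < gauss_density u ^+ 2.
  by rewrite exprn_gt0 // divr_gt0 ?expR_gt0 // sqrtr_gt0 mulr_gt0 // pi_gt0.
pose N := maxn N1 N2.
have hK n : (N <= n)%N -> h n <= K / Num.sqrt n%:R.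
  by rewrite geq_max => /andP[_ /Hh []].
have hc n : (N <= n)%N -> c / Num.sqrt n%:R <= h n + h n.+1.
  by rewrite geq_max => /andP[_ /Hh []].
have JcN n : (N <= n)%N -> c' * n%:R `^ (- (d%:R / alpha)) <= J n.
  by rewrite geq_max => /andP[/Jc].
have inE : in_Dp2 mu E (fun x y => C (tsub x y)) (fun z => if u <= z then 1 else 0) p
    <-> (\sum_(0 <= q <oo) (t q)%:E < +oo)%E.
  rewrite /in_Dp2; set S := (X in (X < _)%E); set S' := (X in _ <-> (X < _)%E).
  suff -> : S = S' by [].
  apply: eq_eseriesr => q _.
  rewrite (cov_integralE mC Cle1 hmu mE M0 EM) -/J.
  by rewrite -(fineK (@hermite_coef_fin_num R u q)) -/(a q) -EFin_expe -!EFinM.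
rewrite inE (eseries_lty_cvg (N := N.+1)); last first.
  exact: (growth_ge0 F0 c'0 tE h0 JcN).
split=> [ct|]; last first.
  exact: (growth_cvg F0 K0 tE h0 hK JK).
rewrite ltNge; apply/negP => ps.
exact: (growth_dvg F0 c0 c'0 tE h0 hc JcN ps).
Qed.
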